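(* Let $n\ge 2$ and let $f$ be a regular polynomial automorphism of $\mathbb{C}^n$ which is not volume-preserving (i.e. $|\det Df|\ne1$). Then $\overline{\dim}_B K<2n$.
   Context: Let $f=(f_1,\dots,f_n)$ be a polynomial automorphism of $\mathbb{C}^n$ (a polynomial map with polynomial inverse), $d=\deg f=\max_i\deg f_i$. View $\mathbb{C}^n\subset\mathbb{P}^n$ with hyperplane at infinity $H_0$, and let $\hat f$ be the extension of $f$ to a meromorphic map of $\mathbb{P}^n$. If $F$ is the homogeneous degree-$d$ polynomial map of $\mathbb{C}^{n+1}$ inducing $\hat f$, the indeterminacy set is $I^+=\pi(F^{-1}(0)\setminus\{0\})\subset H_0$, where $\pi:\mathbb{C}^{n+1}\setminus\{0\}\to\mathbb{P}^n$ is the canonical projection; $I^-$ is the indeterminacy set of $\widehat{f^{-1}}$ defined in the same way. $f$ is regular if $d>1$ and $I^+\cap I^-=\emptyset$. The Jacobian determinant $\det Df$ is constant. $K^{\pm}=\{p\in\mathbb{C}^n:\{f^{\pm k}(p):k\in\mathbb{N}\}\text{ is bounded}\}$, $K=K^+\cap K^-$ (a compact set). $\overline{\dim}_B$ denotes the upper box dimension of a bounded subset of $\mathbb{C}^n\cong\mathbb{R}^{2n}$. *)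

(* Defs.v *)
From mathcomp Require Import all_boot all_order all_algebra.
From mathcomp Require Import all_classical all_reals all_analysis.
From mathcomp Require Import complex.
(* The notations of mpoly clash with those of mathcomp-analysis. *)
From mathcomp Require Import -(notations) mpoly.

Set Implicit Arguments.
Unset Strict Implicit.
Unset Printing Implicit Defensive.

Import Order.TTheory GRing.Theory Num.Theory.
Import numFieldNormedType.Exports.

Local Open Scope classical_set_scope.
Local Open Scope ring_scope.

Local Notation "{ 'mpoly' R [ n ] }" := (mpoly n R)
  (at level 0, R at level 2, n at level 2).

Section PolynomialMaps.
Variable C : numClosedFieldType.

Definition polymap (k m : nat) (f : m.-tuple {mpoly C[k]}) (z : 'rV[C]_k) :
    'rV[C]_m :=
  \row_(i < m) meval (fun j => z ord0 j) (tnth f i).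

Definition polydeg (k m : nat) (f : m.-tuple {mpoly C[k]}) : nat :=
  \max_(i < m) (msize (tnth f i)).-1.

Definition mpolyvar (k : nat) (i : 'I_k) : {mpoly C[k]} :=
  mpolyX C (mnm1 i).

(* x_0^d p(x_1 / x_0, ..., x_n / x_0); meaningful when deg p <= d. *)
Definition homogenize (n d : nat) (p : {mpoly C[n]}) : {mpoly C[n.+1]} :=
  \sum_(m <- msupp p)
     mcoeff m p *:
       (mpolyvar ord0 ^+ (d - mdeg m) *
        \prod_(i < n) mpolyvar (lift ord0 i) ^+ m i).

(* The homogeneous map [x_0^d : ...] of degree d = deg f on C^(n+1) inducing the
   meromorphic extension of f to P^n; C^n sits in P^n as {x_0 = 1}. *)
Definition homlift (n : nat) (f : n.-tuple {mpoly C[n]}) :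
    n.+1.-tuple {mpoly C[n.+1]} :=
  cons_tuple (mpolyvar ord0 ^+ polydeg f)
             (map_tuple (homogenize (polydeg f)) f).

(* Points of P^n are encoded as the lines <[v]>, v != 0, of C^(n+1). *)
Definition indeterminacy (n : nat) (f : n.-tuple {mpoly C[n]}) :
    set {vspace 'rV[C]_n.+1} :=
  [set <[v]>%VS | v in [set v | polymap (homlift f) v = 0 /\ v != 0]].

Definition jacobian_det (n : nat) (f : n.-tuple {mpoly C[n]}) (z : 'rV[C]_n) : C :=
  \det (\matrix_(i < n, j < n)
          meval (fun k => z ord0 k) (mderiv j (tnth f i))).

Record polyaut (n : nat) := PolyAut {
  aut_fun : n.-tuple {mpoly C[n]};
  aut_inv : n.-tuple {mpoly C[n]};
  aut_funK : cancel (polymap aut_fun) (polymap aut_inv);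
  aut_invK : cancel (polymap aut_inv) (polymap aut_fun) }.

Definition regular_aut (n : nat) (f : polyaut n) : Prop :=
  (1 < polydeg (aut_fun f))%N /\
  indeterminacy (aut_fun f) `&` indeterminacy (aut_inv f) = set0.

Definition volume_preserving (n : nat) (f : polyaut n) : Prop :=
  forall z : 'rV[C]_n, `|jacobian_det (aut_fun f) z| = 1.

End PolynomialMaps.

Section BoxDimension.
Variables (R : realType) (T : pseudoMetricType R).
Local Open Scope ereal_scope.

(* Least number of e-balls covering A, and +oo if no finite family does. *)
Definition covering_number (A : set T) (e : R) : \bar R :=
  ereal_inf [set ((size s)%:R)%:E
            | s in [set s : seq T | A `<=` \bigcup_(c in [set` s]) ball c e]].

Definition upper_box_dim (A : set T) : \bar R :=
  limf_esup (fun e : R => lne (covering_number A e) * ((- ln e)^-1)%:E) 0^'+.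

End BoxDimension.

Section FilledJuliaSet.
Variables (R : realType) (n : nat).
Local Notation C := (complex R).

(* The identification C^n = R^(2n). On 'rV[R]_(n + n) norm and balls are those
   of the max norm; boundedness and box dimension do not depend on this choice. *)
Definition realify (z : 'rV[C]_n) : 'rV[R]_(n + n) :=
  row_mx (map_mx (@complex.Re R) z) (map_mx (@complex.Im R) z).

Definition bounded_orbit (f : n.-tuple {mpoly C[n]}) : set 'rV[C]_n :=
  [set p | bounded_set (range (fun k => realify (iter k (polymap f) p)))].

Definition Kplus (f : polyaut C n) := bounded_orbit (aut_fun f).
Definition Kminus (f : polyaut C n) := bounded_orbit (aut_inv f).
Definition Kset (f : polyaut C n) := Kplus f `&` Kminus f.

End FilledJuliaSet.

(* Main.v *)
Require Import Defs.
From mathcomp Require Import all_boot all_order all_algebra.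
From mathcomp Require Import all_classical all_reals all_analysis.
From mathcomp Require Import complex.
From mathcomp Require Import -(notations) mpoly.
From mathcomp Require Import perm ring lra.

(** Let delta be the Jacobian determinant of f; it is a polynomial without zeros,
    hence a constant.  The filled Julia set K is bounded and f K = K.  Passing to
    the inverse of f if necessary, |delta| < 1, so that f multiplies volumes in
    R^(2n) by |delta|^2 < 1.

    Box dimension.  Let F = f^k.  At a small scale e, F maps a ball of radius e
    to a set that is, up to an error O(e^2), an affine image of the ball under a
    matrix of determinant delta^k.  For a small ratio sigma, such an image is
    covered by at most D |delta|^(2k) sigma^(-2n) balls of radius sigma e, where
    D depends on n only.  With k so large that D |delta|^(2k) <= 1/2, the
    inclusion of K in F K turns a cover of K by N balls of radius e into a cover
    by N sigma^(-2n) / 2 balls of radius sigma e.  Iterating, K is covered by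
    O((sigma^(-2n) / 2)^j) balls of radius sigma^j e0, so its upper box dimension
    is at most 2n - ln 2 / ln (1 / sigma) (contracting_upper_box_dim).

    The count of balls needs no measure theory.  Gaussian elimination with full
    pivoting writes a matrix as X diag(d) Y where the entries of X and Y have
    modulus at most 1 (pivot_factorization).  The factors X and Y distort balls
    by a factor n at most, and the image of a ball under diag(d) is a box, whose
    covering number is a product of covering numbers of discs; this product
    involves d only through |d_1 ... d_n|, the modulus of the determinant
    (linear_image_cover).

    Boundedness of K.  Regularity says that the homogeneous lifts of f and of its
    inverse g have no common zero but 0, so by compactness the sum of their norms
    is bounded below on the unit sphere of C^(n+1).  Evaluated at the point
    (1, z) / |z|, the bound says that f or g grows like a power of |z| of exponent
    at least 2, hence at least doubles |z| when |z| is large (escape).  A point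
    of K that is too large would then have arbitrarily large iterates, forward or
    backward (Kset_bounded).  The inverse g has degree at least 2 because f has:
    if g were affine its derivative would be constant, so would be that of f by
    the chain rule, and f would be affine (polydeg_inverse). *)

Set Implicit Arguments.
Unset Strict Implicit.
Unset Printing Implicit Defensive.

Import Order.TTheory GRing.Theory Num.Theory.
Import numFieldNormedType.Exports.
Import Normc.

Local Open Scope classical_set_scope.
Local Open Scope ring_scope.

(** * The max norm of complex matrices *)

Section MaxNorm.
Variable R : realType.
Local Notation C := (complex R).

Lemma normc_ge0 (x : C) : 0 <= normc x.
Proof. by case: x => a b; exact: sqrtr_ge0. Qed.

Lemma ler_normcD (x y : C) : normc (x + y) <= normc x + normc y.
Proof. exact: (le_normcD (x : Rcomplex R)). Qed.

Lemma normcNE (x : C) : normc (- x) = normc x.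
Proof. exact: (normcN (x : Rcomplex R)). Qed.

Lemma normcX (x : C) k : normc (x ^+ k) = normc x ^+ k.
Proof. by elim: k => [|k IH]; rewrite ?normc1 // !exprS normcM IH. Qed.

Lemma ler_normc_sum (I : Type) (s : seq I) (F : I -> C) :
  normc (\sum_(i <- s) F i) <= \sum_(i <- s) normc (F i).
Proof.
elim: s => [|i s IH]; first by rewrite !big_nil normc0.
by rewrite !big_cons (le_trans (ler_normcD _ _)) // lerD2l.
Qed.

Lemma normc_mul_eq1 (a b : C) :
  a * b = 1 -> normc b = (normc a)^-1.
Proof.
move=> ab1; have nab : normc a * normc b = 1 by rewrite -normcM ab1 normc1.
have a0 : normc a != 0.
  by apply/eqP => a0; move: nab; rewrite a0 mul0r => /esym/eqP; rewrite oner_eq0.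
by rewrite -[RHS]mulr1 -nab mulKf.
Qed.

Lemma normc_real (x : R) : normc (real_complex R x) = `|x|.
Proof. by rewrite /= expr0n /= addr0 sqrtr_sqr. Qed.

Lemma ler_Re_normc (x : C) : `|complex.Re x| <= normc x.
Proof.
by case: x => a b /=; rewrite -sqrtr_sqr ler_wsqrtr // lerDl sqr_ge0.
Qed.

Lemma ler_Im_normc (x : C) : `|complex.Im x| <= normc x.
Proof.
by case: x => a b /=; rewrite -sqrtr_sqr ler_wsqrtr // lerDr sqr_ge0.
Qed.

Lemma ler_normcReIm (x : C) : normc x <= `|complex.Re x| + `|complex.Im x|.
Proof.
case: x => a b /=; rewrite -(ler_pXn2r (n := 2)) ?nnegrE ?sqrtr_ge0 ?addr_ge0 //.
rewrite sqr_sqrtr ?addr_ge0 ?sqr_ge0 // sqrrD !real_normK ?num_real //.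
rewrite lerD2r lerDl mulrn_wge0 // mulr_ge0 //.
Qed.

Section Matrix.
Implicit Types m n p : nat.

(** Real-valued, unlike the norm that matrices over an arbitrary numeric field
    carry, which would live in the partially ordered field of complex numbers. *)
Definition nrm m n (A : 'M[C]_(m, n)) : R :=
  \big[Num.max/0]_(ij : 'I_m * 'I_n) normc (A ij.1 ij.2).

Lemma nrm_ge0 m n (A : 'M[C]_(m, n)) : 0 <= nrm A.
Proof. exact: bigmax_ge_id. Qed.

Lemma le_nrm m n (A : 'M[C]_(m, n)) i j : normc (A i j) <= nrm A.
Proof.
exact: (le_bigmax 0 (fun ij : 'I_m * 'I_n => normc (A ij.1 ij.2)) (i, j)).
Qed.

Lemma nrm_le m n (A : 'M[C]_(m, n)) c :
  0 <= c -> (forall i j, normc (A i j) <= c) -> nrm A <= c.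
Proof. by move=> c0 Ac; apply: bigmax_le => // -[i j] _ /=. Qed.

Lemma nrm0 m n : nrm (0 : 'M[C]_(m, n)) = 0.
Proof.
apply/eqP; rewrite eq_le nrm_ge0 andbT nrm_le // => i j.
by rewrite mxE normc0.
Qed.

Lemma nrm_eq0 m n (A : 'M[C]_(m, n)) : nrm A = 0 -> A = 0.
Proof.
move=> A0; apply/matrixP => i j; rewrite mxE; apply: eq0_normc.
by apply/eqP; rewrite eq_le normc_ge0 andbT -A0 le_nrm.
Qed.

Lemma nrm_gt0 m n (A : 'M[C]_(m, n)) : A != 0 -> 0 < nrm A.
Proof.
by rewrite lt_def nrm_ge0 andbT; apply: contra => /eqP /nrm_eq0 ->.
Qed.

Lemma nrmN m n (A : 'M[C]_(m, n)) : nrm (- A) = nrm A.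
Proof. by apply: eq_bigr => -[i j] _; rewrite mxE normcNE. Qed.

Lemma ler_nrmD m n (A B : 'M[C]_(m, n)) : nrm (A + B) <= nrm A + nrm B.
Proof.
apply: nrm_le => [|i j]; first by rewrite addr_ge0 ?nrm_ge0.
by rewrite mxE (le_trans (ler_normcD _ _)) // lerD ?le_nrm.
Qed.

Lemma ler_nrmB m n (A B : 'M[C]_(m, n)) : nrm (A - B) <= nrm A + nrm B.
Proof. by rewrite -(nrmN B) ler_nrmD. Qed.

Lemma nrm_distrC m n (A B : 'M[C]_(m, n)) : nrm (A - B) = nrm (B - A).
Proof. by rewrite -nrmN opprB. Qed.

Lemma ler_nrm_dist m n (A B D : 'M[C]_(m, n)) :
  nrm (A - B) <= nrm (A - D) + nrm (D - B).
Proof. by rewrite -(subrKA D) ler_nrmD. Qed.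

Lemma nrmZ m n a (A : 'M[C]_(m, n)) : nrm (a *: A) = normc a * nrm A.
Proof.
have le a' (A' : 'M[C]_(m, n)) : nrm (a' *: A') <= normc a' * nrm A'.
  apply: nrm_le => [|i j]; first by rewrite mulr_ge0 ?normc_ge0 ?nrm_ge0.
  by rewrite mxE normcM ler_wpM2l ?normc_ge0 ?le_nrm.
apply/eqP; rewrite eq_le le /=; have [->|a0] := eqVneq a 0.
  by rewrite normc0 mul0r nrm_ge0.
have na0 : 0 < normc a.
  by rewrite lt_def normc_ge0 andbT; apply: contra a0 => /eqP /eq0_normc ->.
rewrite -ler_pdivlMl // -[X in nrm X <= _](scalerK a0) -normcV.
exact: le.
Qed.

Lemma ler_nrmM m n p (A : 'M[C]_(m, n)) (B : 'M[C]_(n, p)) :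
  nrm (A *m B) <= n%:R * nrm A * nrm B.
Proof.
apply: nrm_le => [|i j]; first by rewrite !mulr_ge0 ?nrm_ge0.
rewrite mxE (le_trans (ler_normc_sum _ _)) //.
have -> : n%:R * nrm A * nrm B = \sum_(k < n) nrm A * nrm B.
  by rewrite sumr_const card_ord -mulrA mulr_natl.
by apply: ler_sum => k _; rewrite normcM ler_pM ?normc_ge0 ?le_nrm.
Qed.

End Matrix.

End MaxNorm.

(** * Factorization of a matrix by elimination with full pivoting *)

Section PivotFactorization.
Variable R : realType.
Local Notation C := (complex R).

Lemma nrm_block m1 m2 n1 n2 (A : 'M[C]_(m1, n1)) B D (E : 'M[C]_(m2, n2)) c :
  nrm A <= c -> nrm B <= c -> nrm D <= c -> nrm E <= c ->
  nrm (block_mx A B D E) <= c.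
Proof.
move=> Ac Bc Dc Ec; apply: nrm_le => [|k l].
  exact: le_trans (nrm_ge0 _) Ac.
rewrite -[k]fintype.splitK -[l]fintype.splitK.
by case: (fintype.split k) => k'; case: (fintype.split l) => l' /=;
  rewrite ?block_mxEul ?block_mxEur ?block_mxEdl ?block_mxEdr;
  apply: le_trans (le_nrm _ _ _) _.
Qed.

Lemma nrm_1mx n : nrm (1%:M : 'M[C]_n) <= 1.
Proof.
by apply: nrm_le => // i j; rewrite mxE; case: eqP; rewrite ?normc1 ?normc0.
Qed.

(** The bound 2 ^+ n * M reflects that each elimination step at most doubles the
    entries of the remaining matrix.  Together with the product formula, it bounds
    each pivot from below when the determinant is bounded from below. *)
Definition pivot_factored n (A : 'M[C]_n) (M : R) :=
  exists (X Y : 'M[C]_n) (d : 'rV[C]_n),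
  [/\ A = X *m diag_mx d *m Y, nrm X <= 1, nrm Y <= 1,
      nrm d <= 2 ^+ n * M & normc (\det A) = \prod_i normc (d 0 i)].

(** Permuting rows or columns permutes the rows of X or the columns of Y and
    multiplies the determinant by a sign. *)
Lemma pivot_factored_perm n (A : 'M[C]_n) M i1 i2 j1 j2 :
  pivot_factored (xrow i1 i2 (xcol j1 j2 A)) M -> pivot_factored A M.
Proof.
case=> X [Y [d [defA nX nY nd detA]]].
exists (xrow i1 i2 X), (xcol j1 j2 Y), d; split => //.
- rewrite xrowE xcolE -!mulmxA (mulmxA X) (mulmxA (X *m _)) -defA.
  rewrite xrowE xcolE !mulmxA -perm_mxM tperm2 perm_mx1 mul1mx.
  by rewrite -mulmxA -perm_mxM tperm2 perm_mx1 mulmx1.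
- by apply: nrm_le => // i j; rewrite mxE (le_trans (le_nrm _ _ _)).
- by apply: nrm_le => // i j; rewrite mxE (le_trans (le_nrm _ _ _)).
rewrite -detA xrowE xcolE !det_mulmx !det_perm !normcM !normcX normcNE normc1.
by rewrite !expr1n mul1r mulr1.
Qed.

(** Once an entry of maximal modulus has been moved to the corner, the quotients
    of the first row and column by the pivot have modulus at most 1; they form the
    new row of Y and the new column of X, and the Schur complement is factored by
    induction. *)
Lemma pivot_factorization n (A : 'M[C]_n) M : nrm A <= M -> pivot_factored A M.
Proof.
elim: n A M => [|n IH] A M AM.
  have M0 : 0 <= M by exact: le_trans (nrm_ge0 _) AM.
  exists 0, 0, 0; split; rewrite ?nrm0 ?(flatmx0 A) ?(flatmx0 (_ *m _)) //.
    by rewrite mulr_ge0.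
  by rewrite det_mx00 normc1 big_ord0.
have M0 : 0 <= M by exact: le_trans (nrm_ge0 _) AM.
have [A0|A0] := eqVneq A 0.
  exists 1%:M, 1%:M, 0; rewrite A0 raddf0 mulmx0 mul0mx nrm0 !nrm_1mx.
  by split; rewrite ?mulr_ge0 ?exprn_ge0 // det0 big_ord_recl mxE normc0 mul0r.
have [[i j] /= _ ijmax] := @eq_bigmax _ _ _ 0 (ord0, ord0) predT
  (fun ij : 'I_n.+1 * 'I_n.+1 => normc (A ij.1 ij.2)) isT
  (fun ij _ => normc_ge0 (A ij.1 ij.2)).
rewrite -/(nrm A) in ijmax.
apply: (@pivot_factored_perm _ _ _ i 0 j 0).
pose B := xrow i 0 (xcol j 0 A); rewrite -/B.
have B00 : B 0 0 = A i j by rewrite !mxE !tpermR.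
have Bmax k l : normc (B k l) <= normc (B 0 0).
  by rewrite B00 -ijmax !mxE le_nrm.
have B00_gt0 : 0 < normc (B 0 0) by rewrite B00 -ijmax nrm_gt0.
have B00M : normc (B 0 0) <= M by rewrite B00 -ijmax.
move: B {B00} Bmax B00_gt0 B00M => B Bmax B00_gt0 B00M {A A0 AM ijmax i j}.
pose a : C := B 0 0; rewrite -/a in Bmax B00_gt0 B00M.
have a0 : a != 0 by apply: contraTneq B00_gt0 => ->; rewrite normc0 ltxx.
pose u : 'M[C]_(1, n) := ursubmx (B : 'M[C]_(1 + n)).
pose v : 'M[C]_(n, 1) := dlsubmx (B : 'M[C]_(1 + n)).
pose S : 'M[C]_n := drsubmx (B : 'M[C]_(1 + n)).
have defB : B = block_mx a%:M u v S :> 'M[C]_(1 + n).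
  rewrite -[LHS](@submxK _ 1 n 1 n); congr block_mx.
  by rewrite [LHS]mx11_scalar !mxE /a; congr (B _ _)%:M; apply/val_inj.
have nu : nrm (a^-1 *: u) <= 1.
  apply: nrm_le => // k l; rewrite !mxE normcM normcV.
  by rewrite ler_pdivrMl // mulr1 Bmax.
have nv : nrm (a^-1 *: v) <= 1.
  apply: nrm_le => // k l; rewrite !mxE normcM normcV.
  by rewrite ler_pdivrMl // mulr1 Bmax.
pose T := S - v *m (a^-1 *: u).
have nT : nrm T <= 2 * M.
  apply: nrm_le => [|k l]; first by rewrite mulr_ge0.
  have -> : T k l = S k l - (v *m (a^-1 *: u)) k l.
    by rewrite [LHS]mxE [X in _ + X]mxE.
  rewrite (le_trans (ler_normcD _ _)) // normcNE mulr_natl mulr2n.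
  apply: lerD; first by rewrite !mxE (le_trans (Bmax _ _)).
  rewrite mxE big_ord1 normcM -[M]mulr1 ler_pM ?normc_ge0 //.
    by rewrite !mxE (le_trans (Bmax _ _)).
  exact: le_trans (le_nrm _ _ _) nu.
have [X [Y [d [defT nX nY nd detT]]]] := IH _ _ nT.
have n1 : nrm (1%:M : 'M[C]_1) <= 1 by exact: nrm_1mx.
exists (block_mx 1%:M 0 (a^-1 *: v) X : 'M[C]_(1 + n)).
exists (block_mx 1%:M (a^-1 *: u) 0 Y : 'M[C]_(1 + n)).
exists (row_mx a%:M d : 'rV[C]_(1 + n)).
split.
- rewrite [LHS]defB (@diag_mx_row _ n 1).
  have -> : diag_mx (a%:M : 'rV[C]_1) = a%:M.
    by apply/matrixP => k l; rewrite !ord1 !mxE.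
  rewrite (@mulmx_block _ 1 n 1 n 1 n) ?(mul0mx, mulmx0, add0r, addr0) mul1mx.
  rewrite (@mulmx_block _ 1 n 1 n 1 n) ?(mul0mx, mulmx0, add0r, addr0) -defT !mulmx1.
  rewrite mul_scalar_mx scalerA divff // scale1r mul_mx_scalar.
  rewrite scalerA divff // scale1r /T.
  by rewrite [v *m _ + _]addrC subrK.
- by apply: (@nrm_block 1 n 1 n) => //; rewrite nrm0.
- by apply: (@nrm_block 1 n 1 n) => //; rewrite nrm0.
- apply: nrm_le => [|k l]; first by rewrite mulr_ge0 ?exprn_ge0.
  rewrite -[l](@fintype.splitK 1 n); case: (@fintype.split 1 n l) => l' /=.
    rewrite (@row_mxEl _ 1 1 n) !mxE !ord1 mulr1n (le_trans B00M) //.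
    by rewrite ler_peMl // exprn_ege1 // ler1n.
  by rewrite (@row_mxEr _ 1 1 n) (le_trans (le_nrm _ _ _)) // exprSr -mulrA.
have -> : \det B = a * \det T.
  have -> : B = block_mx 1%:M 0 (a^-1 *: v) 1%:M *m block_mx a%:M u 0 T
      :> 'M[C]_(1 + n).
    rewrite (@mulmx_block _ 1 n 1 n 1 n) ?(mul0mx, mulmx0, add0r, addr0).
    rewrite !mul1mx mul_mx_scalar.
    rewrite scalerA divff // scale1r [LHS]defB.
    by rewrite /T -scalemxAl -scalemxAr [_ + (_ - _)]addrC subrK.
  rewrite det_mulmx (@det_lblock _ 1 n) (@det_ublock _ 1 n).
  by rewrite !det1 !mul1r det_scalar1.
rewrite normcM detT (@big_split_ord _ _ _ 1 n) /= big_ord1.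
rewrite (@row_mxEl _ 1 1 n) mxE mulr1n.
by congr (_ * _); apply: eq_bigr => k _; rewrite (@row_mxEr _ 1 1 n).
Qed.
End PivotFactorization.

(** * Covering linear images of balls *)

Section Covering.
Variable R : realType.
Local Notation C := (complex R).

Lemma interval_cover (r t : R) : 0 < t -> t <= r ->
  exists2 s : seq R, (size s)%:R <= 3 * (r / t) &
    forall x, `|x| <= r -> exists2 c, c \in s & `|x - c| <= t.
Proof.
move=> t0 tr; have r0 : 0 < r by exact: lt_le_trans t0 tr.
pose q := Num.truncn (2 * (r / t)).
exists [seq - r + t * k%:R | k <- iota 0 q.+1].
  have /andP[qle _] : q%:R <= 2 * (r / t) < q.+1%:R.
    by rewrite truncn_itv // mulr_ge0 // divr_ge0 // ltW.
  rewrite size_map size_iota -natr1.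
  have : 1 <= r / t by rewrite ler_pdivlMr ?mul1r.
  by move: (r / t) qle => y; lra.
move=> x /ler_normlP[xr rx].
have y0 : 0 <= (x + r) / t by rewrite divr_ge0 ?(ltW t0) //; lra.
have /andP[kle klt] := truncn_itv y0; set k := Num.truncn _ in kle klt.
exists (- r + t * k%:R).
  apply/mapP; exists k => //; rewrite mem_iota add0n /= ltnS.
  rewrite /q /k le_truncn // mulrA ler_pM2r ?invr_gt0 //; lra.
move: kle klt; rewrite ler_pdivlMr // ltr_pdivrMr // -natr1 mulrDl mul1r.
by rewrite ler_norml [t * _]mulrC => *; apply/andP; split; lra.
Qed.

Lemma disc_cover (r t : R) : 0 < t -> t <= r ->
  exists2 s : seq C, (size s)%:R <= (6 * (r / t)) ^+ 2 &
    forall z, normc z <= r -> exists2 c, c \in s & normc (z - c) <= t.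
Proof.
move=> t0 tr; have t20 : 0 < t / 2 by lra.
have t2r : t / 2 <= r by lra.
have [s ss sP] := interval_cover t20 t2r.
exists [seq Complex a b | a <- s, b <- s].
  rewrite size_allpairs natrM -expr2 lerXn2r ?nnegrE //.
    by rewrite mulr_ge0 // divr_ge0 // ltW // (lt_le_trans t0).
  by apply: le_trans ss _; rewrite invf_div; lra.
move=> z zr.
have [a as_ za] := sP _ (le_trans (ler_Re_normc z) zr).
have [b bs zb] := sP _ (le_trans (ler_Im_normc z) zr).
exists (Complex a b); first by apply/allpairsP; exists (a, b).
rewrite (le_trans (ler_normcReIm _)) //; case: z {zr} za zb => /= x y; lra.
Qed.

(** The choices of one element in each list are enumerated by a dependent finite
    product of ordinals. *)
Lemma seq_product n (S : 'I_n -> seq C) :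
  exists2 s : seq 'rV[C]_n, size s = (\prod_i size (S i))%N &
    forall c : 'rV[C]_n, (forall i, c 0 i \in S i) -> c \in s.
Proof.
pose T := fprod (fun i => 'I_(size (S i)) : finType).
exists [seq \row_i nth 0 (S i) (F i : 'I_(size (S i))) | F : T].
  by rewrite size_image card_fprod; apply: eq_bigr => i _; rewrite card_ord.
move=> c cS; apply/mapP.
have ltc (i : 'I_n) : (index (c 0%R i) (S i) < size (S i))%N by rewrite index_mem.
exists (fprod_of_fun (fun i => Ordinal (ltc i)) : T); first by rewrite mem_enum.
by apply/rowP => i; rewrite mxE fprodE /= nth_index.
Qed.

Lemma box_cover n (r : 'I_n -> R) t : 0 < t -> (forall i, t <= r i) ->
  exists2 s : seq 'rV[C]_n, (size s)%:R <= \prod_i (6 * (r i / t)) ^+ 2 &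
    forall z : 'rV[C]_n, (forall i, normc (z 0 i) <= r i) ->
      exists2 c, c \in s & nrm (z - c) <= t.
Proof.
move=> t0 tr.
have /choice[S SP] : forall i, exists s : seq C,
    (size s)%:R <= (6 * (r i / t)) ^+ 2 /\
    forall z, normc z <= r i -> exists2 c, c \in s & normc (z - c) <= t.
  by move=> i; have [s ss sP] := disc_cover t0 (tr i); exists s.
have [s ss sP] := seq_product S; exists s.
  rewrite ss natr_prod; apply: ler_prod => i _.
  by rewrite ler0n (SP i).1.
move=> z zr.
have /choice[c cP] : forall i, exists c, c \in S i /\ normc (z 0 i - c) <= t.
  by move=> i; have [c cS zc] := (SP i).2 _ (zr i); exists c.
exists (\row_i c i); first by apply: sP => i; rewrite mxE (cP i).1.
apply: nrm_le => [|k i]; first exact: ltW.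
by rewrite ord1 !mxE (cP i).2.
Qed.

(** The number of balls is that of a volume comparison, up to a factor depending
    on n only: (a / t)^(2n) times the factor |det A|^2 by which A multiplies
    volumes in R^(2n).  The upper bound on t makes it smaller than all sides of the
    box obtained after applying X and diag(d), so that rounding up the number of
    balls in each direction costs a constant factor only. *)
Lemma linear_image_cover n (A : 'M[C]_n) (M a t : R) :
    1 <= M -> nrm A <= M -> 0 < normc (\det A) -> 0 < t ->
    t * (2 ^+ n * M) ^+ n <= a * normc (\det A) ->
  exists2 s : seq 'rV[C]_n,
    (size s)%:R <= (6 * n%:R * (a / t)) ^+ (2 * n) * normc (\det A) ^+ 2 &
    forall h : 'rV[C]_n, nrm h <= a ->
      exists2 c, c \in s & nrm (h *m A - c) <= n%:R * t.
Proof.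
move=> M1 AM detA0 t0 ta.
have [X [Y [d [defA nX nY nd detA]]]] := pivot_factorization AM.
set B := 2 ^+ n * M in nd ta *.
have B1 : 1 <= B by rewrite -[1]mulr1 ler_pM // exprn_ege1 // ler1n.
have B0 : 0 < B by exact: lt_le_trans B1.
have a0 : 0 < a.
  by rewrite -(pmulr_lgt0 _ detA0) (lt_le_trans _ ta) // mulr_gt0 // exprn_gt0.
have tr (i : 'I_n) : t <= n%:R * a * normc (d 0 i).
  have n1 : (1 <= n)%N by case: (n) i => // -[].
  have le1 : normc (\det A) <= normc (d 0 i) * B ^+ n.
    rewrite detA (bigD1 i) //= ler_wpM2l ?normc_ge0 //.
    apply: (@le_trans _ _ (\prod_(j < n | j != i) B)).
      apply: ler_prod => j _; rewrite normc_ge0 (le_trans _ nd) //.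
      exact: le_nrm.
    rewrite prodr_const ler_weXn2l //.
    by rewrite -[X in (_ <= X)%N]card_ord max_card.
  (* Every pivot but the i-th is at most B, so that |d_i| >= |det A| / B^n. *)
  have le2 : t <= a * normc (d 0 i).
    rewrite -(ler_pM2r (exprn_gt0 n B0)) (le_trans ta) //.
    by rewrite -mulrA ler_wpM2l // ltW.
  rewrite (le_trans le2) // -mulrA ler_peMl ?ler1n //.
  by rewrite mulr_ge0 ?normc_ge0 // ltW.
have [s ss sP] := box_cover t0 tr.
exists [seq c *m Y | c <- s].
  rewrite size_map (le_trans ss) // prodrXl.
  have -> : \prod_(i < n) (6 * (n%:R * a * normc (d 0 i) / t)) =
            (6 * n%:R * (a / t)) ^+ n * normc (\det A).
    rewrite detA -[n in _ ^+ n]card_ord -prodr_const -big_split /=.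
    by apply: eq_bigr => i _; ring.
  by rewrite exprMn -exprM mulnC.
move=> h ha; have [|c cs hc] := sP (h *m X *m diag_mx d).
  move=> i; rewrite mul_mx_diag mxE normcM ler_wpM2r ?normc_ge0 //.
  rewrite (le_trans (le_nrm _ _ _)) // (le_trans (ler_nrmM _ _)) //.
  rewrite -mulrA ler_wpM2l // -[leRHS]mulr1 ler_pM ?nrm_ge0 //.
exists (c *m Y); first by apply/mapP; exists c.
rewrite defA !mulmxA -mulmxBl (le_trans (ler_nrmM _ _)) //.
by rewrite -mulrA ler_wpM2l // -[leRHS]mulr1 ler_pM ?nrm_ge0.
Qed.
End Covering.

(** * Maps with a Lipschitz derivative *)

Section C11Maps.
Variable R : realType.
Local Notation C := (complex R).

(** Maps whose Taylor remainder of order one is quadratic, uniformly on each ball;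
    J z acts on increments, which are row vectors, from the right, so it is the
    transpose of the usual Jacobian matrix.  The condition is uniform in two points
    of the same ball, rather than in a point and a small increment, in order to be
    stable under composition. *)
Definition C11 n m (phi : 'rV[C]_n -> 'rV[C]_m) (J : 'rV[C]_n -> 'M[C]_(n, m)) :=
  forall r : R, exists2 c : R, 0 <= c & forall z w, nrm z <= r -> nrm w <= r ->
    [/\ nrm (phi z) <= c, nrm (J z) <= c &
        nrm (phi w - phi z - (w - z) *m J z) <= c * nrm (w - z) ^+ 2].

Lemma C11_id n : C11 id (fun _ : 'rV[C]_n => 1%:M).
Proof.
move=> r; exists (`|r| + 1); first by rewrite addr_ge0.
move=> z w zr wr; split.
- by rewrite (le_trans zr) // (le_trans (ler_norm r)) // lerDl.
- by rewrite (le_trans (nrm_1mx _ _)) // lerDr.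
- by rewrite mulmx1 subrr nrm0 mulr_ge0 ?addr_ge0 // sqr_ge0.
Qed.

Lemma C11_lipschitz n m (phi : 'rV[C]_n -> 'rV[C]_m) J : C11 phi J ->
  forall r, exists2 c, 0 <= c & forall z w, nrm z <= r -> nrm w <= r ->
    nrm (phi w - phi z) <= c * nrm (w - z).
Proof.
move=> phiC r; have [c c0 cP] := phiC r.
exists (n%:R * c + c * (2 * `|r|)).
  by rewrite addr_ge0 ?mulr_ge0.
move=> z w zr wr; have [_ Jc err] := cP _ _ zr wr.
rewrite -[phi w - phi z](subrK ((w - z) *m J z)).
rewrite (le_trans (ler_nrmD _ _)) // addrC mulrDl lerD //.
  rewrite (le_trans (ler_nrmM _ _)) // -!mulrA ler_wpM2l // mulrC.
  by rewrite ler_wpM2r ?nrm_ge0.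
rewrite (le_trans err) // -mulrA ler_wpM2l // expr2 ler_wpM2r ?nrm_ge0 //.
rewrite (le_trans (ler_nrmB _ _)) //.
have := ler_norm r; lra.
Qed.

(** The remainder of psi \o phi is the remainder of psi at the increment of phi,
    which is Lipschitz, plus the image of the remainder of phi under L. *)
Lemma C11_comp n m p (phi : 'rV[C]_n -> 'rV[C]_m) (psi : 'rV[C]_m -> 'rV[C]_p) J L :
  C11 phi J -> C11 psi L -> C11 (psi \o phi) (fun z => J z *m L (phi z)).
Proof.
move=> phiC psiC r.
have [c c0 cP] := phiC r; have [d d0 dP] := C11_lipschitz phiC r.
have [e e0 eP] := psiC c.
exists (e + m%:R * c * e + e * d ^+ 2).
  by rewrite !addr_ge0 ?mulr_ge0 ?sqr_ge0.
move=> z w zr wr.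
have [pz Jz errphi] := cP _ _ zr wr; have [pw _ _] := cP _ _ wr zr.
have [qz Lz errpsi] := eP _ _ pz pw; have lip := dP _ _ zr wr.
have mce : 0 <= m%:R * c * e by rewrite !mulr_ge0.
have ed : 0 <= e * d ^+ 2 by rewrite mulr_ge0 ?sqr_ge0.
split.
- by rewrite (le_trans qz) // -addrA lerDl addr_ge0.
- rewrite (le_trans (ler_nrmM _ _)) //.
  apply: (@le_trans _ _ (m%:R * c * e)); last lra.
  by rewrite -!mulrA ler_wpM2l // ler_pM ?nrm_ge0.
have -> : psi (phi w) - psi (phi z) - (w - z) *m (J z *m L (phi z)) =
  (psi (phi w) - psi (phi z) - (phi w - phi z) *m L (phi z)) +
  (phi w - phi z - (w - z) *m J z) *m L (phi z).
  by rewrite mulmxA [(_ - _ *m J z) *m _]mulmxBl addrA subrK.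
rewrite (le_trans (ler_nrmD _ _)) //.
apply: (@le_trans _ _ (e * d ^+ 2 * nrm (w - z) ^+ 2
                       + m%:R * c * e * nrm (w - z) ^+ 2)); last first.
  by rewrite -mulrDl ler_wpM2r ?sqr_ge0 //; lra.
apply: lerD.
  rewrite (le_trans errpsi) // -mulrA ler_wpM2l // -exprMn.
  by rewrite lerXn2r ?nnegrE ?mulr_ge0 ?nrm_ge0.
rewrite (le_trans (ler_nrmM _ _)) //.
have -> : m%:R * c * e * nrm (w - z) ^+ 2 =
          m%:R * (c * nrm (w - z) ^+ 2 * e) by ring.
by rewrite -mulrA ler_wpM2l // ler_pM ?nrm_ge0.
Qed.

Lemma C11_iter n (phi : 'rV[C]_n -> 'rV[C]_n) J eta k : C11 phi J ->
    (forall z, normc (\det (J z)) = eta) ->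
  exists2 Jk, C11 (iter k phi) Jk & forall z, normc (\det (Jk z)) = eta ^+ k.
Proof.
move=> phiC detJ; elim: k => [|k [Jk phikC detJk]].
  exists (fun=> 1%:M); first exact: C11_id.
  by move=> z; rewrite det1 normc1.
exists (fun z => Jk z *m J (iter k phi z)); first exact: (C11_comp phikC phiC).
by move=> z; rewrite det_mulmx normcM detJk detJ exprSr.
Qed.

Lemma le0_of_small_multiples (x c : R) :
  (forall t, 0 < t -> t <= 1 -> x <= t * c) -> x <= 0.
Proof.
move=> xc; rewrite leNgt; apply/negP => x0.
have c0 : 0 < c by have := xc 1 ltr01 (lexx _); rewrite mul1r; apply: lt_le_trans.
have xc' : x <= c by rewrite -[c]mul1r xc.
have t0 : 0 < x / (2 * c) by rewrite divr_gt0 // mulr_gt0.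
have t1 : x / (2 * c) <= 1 by rewrite ler_pdivrMr ?mulr_gt0 // mul1r; lra.
have := xc _ t0 t1.
have -> : x / (2 * c) * c = x / 2 by field; rewrite lt0r_neq0.
lra.
Qed.

(** The difference of two derivatives is linear in the increment and at most
    quadratic in its size, hence zero. *)
Lemma C11_unique n m (phi psi : 'rV[C]_n -> 'rV[C]_m) J L :
  C11 phi J -> C11 psi L -> phi =1 psi -> J =1 L.
Proof.
move=> phiC psiC eqphi z; apply/eqP; rewrite -subr_eq0; apply/eqP/nrm_eq0.
apply/eqP; rewrite eq_le nrm_ge0 andbT.
have [c c0 cP] := phiC (nrm z + 1); have [d d0 dP] := psiC (nrm z + 1).
apply: nrm_le => // i j; apply: (@le0_of_small_multiples _ (c + d)) => t t0 t1.
(* The increment t e_i reads off the i-th row of the difference of the derivatives. *)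
pose h : 'rV[C]_n := real_complex R t *: delta_mx 0 i.
have nt : normc (real_complex R t) = t by rewrite normc_real gtr0_norm.
have nh : nrm h <= t.
  apply: nrm_le => [|k l]; first exact: ltW.
  rewrite 2!mxE normcM nt; case: (_ && _); rewrite ?normc1 ?normc0 ?mulr1 //.
  by rewrite mulr0 ltW.
have zr : nrm z <= nrm z + 1 by rewrite lerDl.
have wr : nrm (z + h) <= nrm z + 1.
  by rewrite (le_trans (ler_nrmD _ _)) // lerD2l (le_trans nh).
have [_ _ err1] := cP _ _ zr wr; have [_ _ err2] := dP _ _ zr wr.
rewrite !eqphi in err1; rewrite [z + h]addrC addrK in err1 err2.
have : nrm (h *m (J z - L z)) <= (c + d) * t ^+ 2.
  have -> : h *m (J z - L z) =
     (psi (h + z) - psi z - h *m L z) - (psi (h + z) - psi z - h *m J z).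
    by rewrite mulmxBr opprB addrCA addrAC subrr add0r addrC.
  rewrite (le_trans (ler_nrmB _ _)) //.
  have h2 : nrm h ^+ 2 <= t ^+ 2 by rewrite lerXn2r ?nnegrE ?nrm_ge0 // ltW.
  rewrite mulrDl addrC lerD //.
    by rewrite (le_trans err1) // ler_wpM2l.
  by rewrite (le_trans err2) // ler_wpM2l.
move/(le_trans (le_nrm _ 0 j)).
by rewrite /h -scalemxAl -rowE !mxE normcM nt expr2 mulrCA ler_pM2l // [_ * t]mulrC.
Qed.

(** The scalar case of C11, for which products make sense. *)
Definition C11_fun n (u : 'rV[C]_n -> C) (du : 'rV[C]_n -> 'cV[C]_n) :=
  forall r : R, exists2 c : R, 0 <= c & forall z w, nrm z <= r -> nrm w <= r ->
    [/\ normc (u z) <= c, nrm (du z) <= c &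
        normc (u w - u z - ((w - z) *m du z) 0 0) <= c * nrm (w - z) ^+ 2].

Lemma C11_coord n m (phi : 'rV[C]_n -> 'rV[C]_m) J :
  (forall i, C11_fun (fun z => phi z 0 i) (fun z => col i (J z))) -> C11 phi J.
Proof.
move=> phiC r.
have /choice[c cP] : forall i, exists c : R, 0 <= c /\
  forall z w, nrm z <= r -> nrm w <= r ->
    [/\ normc (phi z 0 i) <= c, nrm (col i (J z)) <= c &
     normc (phi w 0 i - phi z 0 i - ((w - z) *m col i (J z)) 0 0)
       <= c * nrm (w - z) ^+ 2].
  by move=> i; have [c c0 cP] := phiC i r; exists c.
pose d := \sum_i c i.
have cd i : c i <= d.
  by rewrite /d (bigD1 i) //= lerDl sumr_ge0 // => j _; exact: (cP j).1.
have d0 : 0 <= d by rewrite sumr_ge0 // => j _; exact: (cP j).1.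
exists d => // z w zr wr; split; apply: nrm_le => //.
- by move=> k i; rewrite ord1 (le_trans _ (cd i)) //; have [] := (cP i).2 z w zr wr.
- move=> k i; rewrite (le_trans _ (cd i)) //; have [_ + _] := (cP i).2 z w zr wr.
  by apply: le_trans; have := le_nrm (col i (J z)) k 0; rewrite mxE.
- by rewrite mulr_ge0 ?sqr_ge0.
move=> k i; rewrite ord1; have [_ _] := (cP i).2 z w zr wr.
have -> : ((w - z) *m col i (J z)) 0 0 = ((w - z) *m J z) 0 i.
  by rewrite colE mulmxA -colE mxE.
have -> : (phi w - phi z - (w - z) *m J z) 0 i =
    phi w 0 i - phi z 0 i - ((w - z) *m J z) 0 i by rewrite !mxE.
by move=> /le_trans -> //; rewrite ler_wpM2r ?sqr_ge0.
Qed.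

Lemma C11_fun_const n (a : C) : C11_fun (fun _ : 'rV[C]_n => a) (fun=> 0).
Proof.
move=> r; exists (normc a); first exact: normc_ge0.
move=> z w _ _; split; rewrite ?nrm0 ?normc_ge0 //.
by rewrite mulmx0 mxE !subrr normc0 mulr_ge0 ?normc_ge0 ?sqr_ge0.
Qed.

Lemma C11_fun_var n (i : 'I_n) :
  C11_fun (fun z : 'rV[C]_n => z 0 i) (fun=> delta_mx i 0).
Proof.
move=> r; exists (`|r| + 1); first by rewrite addr_ge0.
move=> z w zr wr; split.
- rewrite (le_trans (le_nrm _ _ _)) // (le_trans zr) //.
  by rewrite (le_trans (ler_norm r)) // lerDl.
- apply: nrm_le => [|k l]; first by rewrite addr_ge0.
  by rewrite mxE; case: (_ && _); rewrite ?normc1 ?normc0 ?lerDr ?addr_ge0.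
- by rewrite -colE !mxE subrr normc0 mulr_ge0 ?addr_ge0 // sqr_ge0.
Qed.

Lemma C11_funD n (u v : 'rV[C]_n -> C) du dv : C11_fun u du -> C11_fun v dv ->
  C11_fun (fun z => u z + v z) (fun z => du z + dv z).
Proof.
move=> uC vC r; have [c c0 cP] := uC r; have [d d0 dP] := vC r.
exists (c + d); first exact: addr_ge0.
move=> z w zr wr; have [uz duz eu] := cP z w zr wr; have [vz dvz ev] := dP z w zr wr.
split.
- by rewrite (le_trans (ler_normcD _ _)) // lerD.
- by rewrite (le_trans (ler_nrmD _ _)) // lerD.
have -> : u w + v w - (u z + v z) - ((w - z) *m (du z + dv z)) 0 0 =
  (u w - u z - ((w - z) *m du z) 0 0) + (v w - v z - ((w - z) *m dv z) 0 0).
  by rewrite mulmxDr [X in _ - X]mxE; ring.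
by rewrite mulrDl (le_trans (ler_normcD _ _)) // lerD.
Qed.

(** The remainder of a product is the product of the two increments, which is
    quadratic, plus a combination of the two remainders with bounded
    coefficients. *)
Lemma C11_funM n (u v : 'rV[C]_n -> C) du dv : C11_fun u du -> C11_fun v dv ->
  C11_fun (fun z => u z * v z) (fun z => v z *: du z + u z *: dv z).
Proof.
move=> uC vC r; have [c c0 cP] := uC r; have [d d0 dP] := vC r.
(* u has Lipschitz constant c (n + 2 |r|) on the ball of radius r: n c for the
   linear part, and 2 |r| bounds one factor of the quadratic remainder. *)
pose K : R := (n%:R + 2 * `|r|) ^+ 2.
exists (2 * (c * d) + K * (c * d)).
  by rewrite !(addr_ge0, mulr_ge0) // sqr_ge0.
move=> z w zr wr; have [uz duz eu] := cP z w zr wr; have [vz dvz ev] := dP z w zr wr.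
have cd0 : 0 <= c * d by rewrite mulr_ge0.
have Kcd0 : 0 <= K * (c * d) by rewrite mulr_ge0 // sqr_ge0.
have wz : nrm (w - z) <= 2 * `|r|.
  by rewrite (le_trans (ler_nrmB _ _)) //; have := ler_norm r; lra.
have lip (x y : C) (D : 'cV[C]_n) e : 0 <= e -> nrm D <= e ->
    normc (x - y - ((w - z) *m D) 0 0) <= e * nrm (w - z) ^+ 2 ->
    normc (x - y) <= e * ((n%:R + 2 * `|r|) * nrm (w - z)).
  move=> e0 De err; rewrite -[x - y](subrK (((w - z) *m D) 0 0)).
  rewrite (le_trans (ler_normcD _ _)) // addrC mulrDl mulrDr lerD //.
    rewrite (le_trans (le_nrm _ _ _)) // (le_trans (ler_nrmM _ _)) //.
    by rewrite mulrC ler_wpM2r ?mulr_ge0 ?nrm_ge0.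
  by rewrite (le_trans err) // ler_wpM2l // expr2 ler_wpM2r ?nrm_ge0.
have lu := lip _ _ _ _ c0 duz eu; have lv := lip _ _ _ _ d0 dvz ev.
split.
- rewrite normcM; apply: (@le_trans _ _ (c * d)); last lra.
  by rewrite ler_pM ?normc_ge0.
- rewrite (le_trans (ler_nrmD _ _)) // !nrmZ.
  apply: (@le_trans _ _ (d * c + c * d)); last lra.
  by rewrite lerD // ler_pM ?normc_ge0 ?nrm_ge0.
have -> : u w * v w - u z * v z -
    ((w - z) *m (v z *: du z + u z *: dv z)) 0 0 =
  (u w - u z) * (v w - v z) + (v z * (u w - u z - ((w - z) *m du z) 0 0)
    + u z * (v w - v z - ((w - z) *m dv z) 0 0)).
  have entries (a b : C) (X Y : 'M[C]_1) :
      (a *: X + b *: Y) 0 0 = a * X 0 0 + b * Y 0 0 by rewrite !mxE.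
  by rewrite mulmxDr -!scalemxAr entries; ring.
rewrite (le_trans (ler_normcD _ _)) // [leLHS]addrC [leRHS]mulrDl lerD //.
  rewrite (le_trans (ler_normcD _ _)) // !normcM.
  apply: (@le_trans _ _ (d * (c * nrm (w - z) ^+ 2) + c * (d * nrm (w - z) ^+ 2))).
    by rewrite lerD // ler_pM ?normc_ge0.
  by rewrite le_eqVlt; apply/orP; left; apply/eqP; ring.
rewrite normcM (le_trans (ler_pM _ _ lu lv)) ?normc_ge0 // /K.
by rewrite le_eqVlt; apply/orP; left; apply/eqP; ring.
Qed.
End C11Maps.

(** * Box dimension of sets invariant under a volume-contracting map *)

Section Dimension.
Variable R : realType.
Local Notation C := (complex R).

Definition covered n (K : set 'rV[C]_n) (e N : R) :=
  exists2 s : seq 'rV[C]_n, (size s)%:R <= N &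
    forall z, K z -> exists2 c, c \in s & nrm (z - c) <= e.

Lemma covered_bounded n (K : set 'rV[C]_n) r e : 0 < e ->
  (forall z, K z -> nrm z <= r) -> exists2 N, 1 <= N & covered K e N.
Proof.
move=> e0 Kr; pose r' := Num.max e r.
have er (i : 'I_n) : e <= r' by rewrite le_max lexx.
have [s ss sP] := box_cover e0 er.
exists (1 + (size s)%:R); first by rewrite lerDl.
exists s; first by rewrite lerDr.
move=> z /Kr zr; apply: sP => i.
by rewrite (le_trans (le_nrm _ _ _)) // le_max zr orbT.
Qed.

(** One refinement step.  Each ball that meets K is first recentered at a point
    x' of K, at the cost of doubling its radius, so that the constants of phi on
    the ball of radius r apply.  Then phi is replaced by its affine approximation
    at x'; the error is at most t for e <= e0, and the linear image is covered by
    balls of radius n t, whence a final radius (n + 1) t = sigma e. *)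
Lemma covered_image n (K : set 'rV[C]_n) phi J (eta r : R) :
    C11 phi J -> 0 < eta -> (forall z, normc (\det (J z)) = eta) ->
    (forall z, K z -> nrm z <= r) ->
  exists2 sigma0, 0 < sigma0 & forall sigma, 0 < sigma -> sigma <= sigma0 ->
  exists2 e0, 0 < e0 & forall e N, 0 < e -> e <= e0 -> covered K e N ->
    covered (phi @` K) (sigma * e)
      (N * ((12 * n%:R * n.+1%:R / sigma) ^+ (2 * n) * eta ^+ 2)).
Proof.
move=> phiC eta0 detJ Kr; have [c c0 cP] := phiC r.
pose M := c + 1; pose B := 2 ^+ n * M.
have M1 : 1 <= M by rewrite /M lerDr.
have B0 : 0 < B by rewrite mulr_gt0 ?exprn_gt0 // (lt_le_trans _ M1).
exists (eta / B ^+ n); first by rewrite divr_gt0 // exprn_gt0.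
move=> sigma sigma0 sigma_le.
have n0 : 0 < n.+1%:R :> R by rewrite ltr0n.
have c4 : 0 < 4 * c + 1 by lra.
exists (sigma / (n.+1%:R * (4 * c + 1))); first by rewrite divr_gt0 // mulr_gt0.
move=> e N e0 e_le [s ss sK].
pose t := sigma * e / n.+1%:R.
have t0 : 0 < t by rewrite divr_gt0 // mulr_gt0.
have err : c * (2 * e) ^+ 2 <= t.
  rewrite /t ler_pdivlMr // expr2.
  move: e_le; rewrite ler_pdivlMr ?mulr_gt0 // => e_le.
  apply: (@le_trans _ _ (e * (n.+1%:R * (4 * c + 1)) * e)).
    rewrite -subr_ge0.
    have -> : e * (n.+1%:R * (4 * c + 1)) * e - c * (2 * e * (2 * e)) * n.+1%:R =
      n.+1%:R * e * e by ring.
    by rewrite !mulr_ge0 // ltW.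
  by rewrite ler_wpM2r // ltW.
have tB : t * B ^+ n <= 2 * e * eta.
  move: sigma_le; rewrite ler_pdivlMr ?exprn_gt0 // => sigma_le.
  apply: (@le_trans _ _ (sigma * e * B ^+ n)).
    rewrite ler_wpM2r ?exprn_ge0 ?(ltW B0) // /t ler_pdivrMr // ler_peMr //.
      by rewrite mulr_ge0 // ltW.
    by rewrite ler1n.
  rewrite mulrAC [2 * e * _]mulrAC ler_wpM2r ?(ltW e0) //.
  by rewrite (le_trans sigma_le) //; lra.
pose q := (6 * n%:R * (2 * e / t)) ^+ (2 * n) * eta ^+ 2.
have locally x : exists s' : seq 'rV[C]_n, (size s')%:R <= q /\
    forall z, K z -> nrm (z - x) <= e ->
      exists2 y, y \in s' & nrm (phi z - y) <= sigma * e.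
  have [[x' [Kx' xx']]|nox] := pselect (exists x', K x' /\ nrm (x' - x) <= e);
    last first.
    exists [::]; split => [|z Kz zx]; last by case: nox; exists z.
    by rewrite /q mulr_ge0 ?exprn_ge0 ?mulr_ge0 // ?invr_ge0 ltW.
  have [px' Jx' _] := cP _ _ (Kr _ Kx') (Kr _ Kx').
  have JM : nrm (J x') <= M by rewrite (le_trans Jx') // lerDl.
  have dx' : 0 < normc (\det (J x')) by rewrite detJ.
  have tB' : t * (2 ^+ n * M) ^+ n <= 2 * e * normc (\det (J x')) by rewrite detJ.
  have [s' ss' s'P] := linear_image_cover M1 JM dx' t0 tB'.
  exists [seq phi x' + y | y <- s']; split; first by rewrite size_map /q -(detJ x').
  move=> z Kz zx.
  have zx' : nrm (z - x') <= 2 * e.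
    by rewrite (le_trans (ler_nrm_dist _ _ x)) // (nrm_distrC x x'); lra.
  have [y ys' hy] := s'P _ zx'.
  exists (phi x' + y); first by apply/mapP; exists y.
  have [_ _ taylor] := cP _ _ (Kr _ Kx') (Kr _ Kz).
  have -> : phi z - (phi x' + y) =
    (phi z - phi x' - (z - x') *m J x') + ((z - x') *m J x' - y).
    by rewrite addrA subrK opprD addrA.
  rewrite (le_trans (ler_nrmD _ _)) //.
  have -> : sigma * e = t + n%:R * t.
    by rewrite /t -[n.+1%:R]natr1; field; rewrite natr1 lt0r_neq0.
  rewrite lerD // (le_trans taylor) // (le_trans _ err) // ler_wpM2l //.
  by rewrite lerXn2r ?nnegrE ?nrm_ge0 // mulr_ge0 // ltW.
have [S SP] := choice locally.
exists (flatten [seq S x | x <- s]).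
  have -> : (12 * n%:R * n.+1%:R / sigma) ^+ (2 * n) * eta ^+ 2 = q.
    rewrite /q /t; congr (_ ^+ _ * _); field.
    by rewrite !lt0r_neq0.
  apply: (@le_trans _ _ ((size s)%:R * q)).
    elim: (s) => [|x s' IH]; first by rewrite mul0r.
    by rewrite /= size_cat natrD -natr1 mulrDl mul1r addrC lerD // (SP x).1.
  by rewrite ler_wpM2r // /q mulr_ge0 ?exprn_ge0 ?mulr_ge0 // ?invr_ge0 ltW.
move=> _ [z Kz <-]; have [x xs zx] := sK _ Kz.
have [y yS zy] := (SP x).2 _ Kz zx.
by exists y => //; apply/flattenP; exists (S x) => //; apply/mapP; exists x.
Qed.

Lemma expr_small (x e : R) : 0 < x < 1 -> 0 < e -> exists k, x ^+ k <= e.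
Proof.
move=> /andP[x0 x1] e0.
have xlim : (fun k => x ^+ k) @ \oo --> (0 : R).
  by apply: cvg_expr; rewrite ger0_norm // ltW.
have /cvgrPdist_le /(_ _ e0) [k _ kP] := xlim.
exists k; have := kP k (leqnn k).
by rewrite sub0r normrN ger0_norm // exprn_ge0 // ltW.
Qed.

(** The factor D in the number of balls does not depend on the map, so the
    refinement step for a large iterate of phi gains a factor 2 over the
    sigma^(-2n) balls needed to refine a cover of an open set. *)
Lemma contracting_covered n (K : set 'rV[C]_n) phi J (eta r : R) :
    (0 < n)%N -> C11 phi J -> 0 < eta < 1 ->
    (forall z, normc (\det (J z)) = eta) ->
    (forall z, K z -> nrm z <= r) -> K `<=` phi @` K ->
  exists sigma e0 N0 : R, [/\ 0 < sigma < 1, 0 < e0, 1 <= N0,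
    1 <= (2 * sigma ^+ (2 * n))^-1 &
    forall j, covered K (sigma ^+ j * e0) (N0 * (2 * sigma ^+ (2 * n))^-1 ^+ j)].
Proof.
move=> n0 phiC /andP[eta0 eta1] detJ Kr Kphi.
pose D : R := (12 * n%:R * n.+1%:R) ^+ (2 * n).
have D0 : 0 < D by rewrite exprn_gt0 // !mulr_gt0 ?ltr0n.
(* A step with the k-th iterate multiplies the count by D eta^(2k) / sigma^(2n). *)
have [k kP] : exists k, (eta ^+ 2) ^+ k <= (2 * D)^-1.
  apply: expr_small; last by rewrite invr_gt0 mulr_gt0.
  by rewrite exprn_gt0 //= exprn_ilt1 // ltW.
have [Jk phikC detJk] := C11_iter k phiC detJ.
have Kphik : K `<=` iter k phi @` K.
  elim: (k) => [|i IH] z Kz; first by exists z.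
  have [y Ky <-] := Kphi _ Kz; have [x Kx <-] := IH _ Ky.
  by exists x.
have etak0 : 0 < eta ^+ k by rewrite exprn_gt0.
have [s0 s0_gt0 s0P] := covered_image phikC etak0 detJk Kr.
(* The cap 1 / 2 makes the growth rate 1 / (2 sigma^(2n)) at least 1. *)
pose sigma := Num.min s0 (1 / 2).
have sigma0 : 0 < sigma by rewrite lt_min s0_gt0; lra.
have sigmale : sigma <= 1 / 2 by rewrite ge_min lexx orbT.
have [|e0 e00 e0P] := s0P _ sigma0; first by rewrite ge_min lexx.
have [N0 N01 N0P] := covered_bounded e00 Kr.
have s1 : 0 < sigma ^+ (2 * n) by rewrite exprn_gt0.
exists sigma, e0, N0; split => //; first by rewrite sigma0; lra.
- rewrite invf_ge1 ?mulr_gt0 //.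
  have : sigma ^+ (2 * n) <= sigma.
    by rewrite -[leRHS]expr1 ler_wiXn2l ?(ltW sigma0) //; [lra|rewrite muln_gt0].
  lra.
elim=> [|j IH]; first by rewrite !expr0 mul1r mulr1.
have ej : sigma ^+ j * e0 <= e0.
  by rewrite ler_piMl ?(ltW e00) // exprn_ile1 ?(ltW sigma0) //; lra.
have ej0 : 0 < sigma ^+ j * e0 by rewrite mulr_gt0 // exprn_gt0.
have [s ss sP] := e0P _ _ ej0 ej IH.
exists s; last by move=> z /Kphik /sP; rewrite exprS -mulrA.
rewrite (le_trans ss) // -mulrA ler_wpM2l ?(le_trans ler01) //.
rewrite [leRHS]exprSr ler_wpM2l ?exprn_ge0 ?invr_ge0 ?mulr_ge0 ?(ltW s1) //.
rewrite expr_div_n -/D mulrAC -exprM mulnC exprM invfM.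
rewrite ler_wpM2r ?invr_ge0 ?(ltW s1) //.
by move: kP; rewrite invfM ler_pdivlMr // mulrC.
Qed.

Lemma ball_realify n (c z : 'rV[C]_n) (e : R) : nrm (z - c) < e ->
  ball (realify c) e (realify z).
Proof.
move=> zc; have e0 : 0 < e by rewrite (le_lt_trans _ zc) ?nrm_ge0.
split => // i k; rewrite -[k]fintype.splitK /realify.
case: (fintype.split k) => l /=; rewrite ?row_mxEl ?row_mxEr !mxE ord1.
  rewrite /ball /= -normrN opprB (le_lt_trans _ zc) //.
  have := le_trans (ler_Re_normc _) (le_nrm (z - c) 0 l).
  by rewrite !mxE; case: (z 0 l) (c 0 l) => ? ? [].
rewrite /ball /= -normrN opprB (le_lt_trans _ zc) //.
have := le_trans (ler_Im_normc _) (le_nrm (z - c) 0 l).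
by rewrite !mxE; case: (z 0 l) (c 0 l) => ? ? [].
Qed.

Lemma covering_number_le n (K : set 'rV[C]_n) (e e' N : R) :
  covered K e N -> e < e' ->
  (covering_number (@realify R n @` K) e' <= N%:E)%E.
Proof.
move=> [s ss sP] ee'.
apply: (@le_trans _ _ ((size s)%:R%:E)); last by rewrite lee_fin.
apply: ereal_inf_lbound; exists (map (@realify R n) s); last by rewrite size_map.
move=> _ [z Kz <-]; have [c cs zc] := sP _ Kz.
exists (realify c); first by apply/mapP; exists c.
by apply: ball_realify; exact: le_lt_trans ee'.
Qed.

Lemma covering_number_ge0 (T : pseudoMetricType R) (A : set T) e :
  (0 <= covering_number A e)%E.
Proof. by apply: le_ereal_inf_tmp => _ [s _ <-]; rewrite lee_fin. Qed.

(** For e between sigma^j e0 and sigma^(j-1) e0, the logarithm of the covering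
    number is at most ln N0 + j ln q, and j ln (1 / sigma) is - ln e up to a
    constant; any s above the quotient of the two rates absorbs the constants once
    e is small. *)
Lemma upper_box_dim_le n (K : set 'rV[C]_n) (sigma e0 N0 q s : R) :
    0 < sigma < 1 -> 0 < e0 -> 1 <= N0 -> 1 <= q ->
    (forall j, covered K (sigma ^+ j * e0) (N0 * q ^+ j)) ->
    ln q / - ln sigma < s ->
  (upper_box_dim (@realify R n @` K) <= s%:E)%E.
Proof.
move=> /andP[sigma0 sigma1] e00 N01 q1 cov qs.
set La := - ln sigma in qs.
have La0 : 0 < La by rewrite oppr_gt0 ln_lt0 // sigma0.
have lnq0 : 0 <= ln q by rewrite ln_ge0.
set s0 := ln q / La in qs.
have s00 : 0 <= s0 by rewrite divr_ge0 // ltW.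
pose A := ln N0 + ln q + ln e0 * s0.
have ds : 0 < s - s0 by rewrite subr_gt0.
pose L := 1 + `|A| / (s - s0) + `|ln e0|.
have Apos : 0 <= `|A| / (s - s0) by rewrite divr_ge0 // ltW.
pose V : set R := [set e | 0 < e /\ e < expR (- L)].
apply: (@le_trans _ _ (ereal_sup ((fun e : R =>
   lne (covering_number (@realify R n @` K) e) * ((- ln e)^-1)%:E)%E @` V))).
  apply: ereal_inf_lbound; exists V => //.
  have H : \forall e \near (0 : R)^'+, 0 < e /\ e < expR (- L).
    near=> e; split; near: e; first exact: nbhs_right_gt.
    by apply: nbhs_right_lt; exact: expR_gt0.
  exact: H.
apply: ge_ereal_sup => _ [e [e_gt0 e_lt] <-].
have lne_lt : ln e < - L by rewrite -[- L]expRK ltr_ln ?posrE ?expR_gt0.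
have lne0_ge := ler_norm (- ln e0); rewrite normrN in lne0_ge.
have x0 : 0 <= (ln e0 - ln e) / La.
  by rewrite divr_ge0 ?(ltW La0) //; rewrite /L in lne_lt; lra.
have /andP[jle jlt] := truncn_itv x0.
set j := (Num.truncn _).+1 in jlt.
(* The balls of the box dimension are open, those of the covers are closed. *)
have small : sigma ^+ j * e0 < e.
  rewrite -ltr_ln ?posrE ?mulr_gt0 ?exprn_gt0 //.
  rewrite lnM ?posrE ?exprn_gt0 // lnXn //.
  move: jlt; rewrite ltr_pdivrMr // /La -mulr_natl; lra.
have N0q : 0 < N0 * q ^+ j.
  by rewrite mulr_gt0 ?exprn_gt0 ?(lt_le_trans ltr01).
have le1 : (lne (covering_number (@realify R n @` K) e) <= (ln (N0 * q ^+ j))%:E)%E.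
  rewrite -lne_EFin // lee_lne ?in_itv /= ?leey ?covering_number_ge0 //.
    exact: (covering_number_le (cov j) small).
  by rewrite lee_fin ltW.
have lnN : ln (N0 * q ^+ j) <= A - s0 * ln e.
  rewrite lnM ?posrE ?exprn_gt0 ?(lt_le_trans ltr01) // lnXn ?(lt_le_trans ltr01) //.
  have jq : j%:R * ln q <= (ln e0 - ln e) * s0 + ln q.
    apply: (@le_trans _ _ (((ln e0 - ln e) / La + 1) * ln q)).
      by rewrite ler_wpM2r // /j -natr1 lerD2r.
    by rewrite mulrDl mul1r lerD2r /s0 mulrAC mulrA.
  rewrite -mulr_natl (le_trans (lerD (lexx _) jq)) // /A mulrBl [s0 * _]mulrC.
  by rewrite !addrA le_eqVlt; apply/orP; left; apply/eqP; ring.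
have Lne : L < - ln e by rewrite ltrNr.
have L0 : 0 < - ln e by rewrite (lt_trans _ Lne) // /L !ltr_wpDr.
apply: (@le_trans _ _ ((ln (N0 * q ^+ j))%:E * ((- ln e)^-1)%:E)%E).
  by rewrite lee_wpmul2r // lee_fin invr_ge0 ltW.
rewrite -EFinM lee_fin ler_pdivrMr // (le_trans lnN) //.
rewrite lerBlDr.
have -> : s * - ln e + s0 * ln e = (s - s0) * - ln e by ring.
rewrite -ler_pdivrMl // mulrC (le_trans _ (ltW Lne)) // /L.
apply: (@le_trans _ _ (`|A| / (s - s0))).
  by rewrite ler_wpM2r ?ler_norm // invr_ge0 ltW.
by rewrite -addrA addrCA lerDl addr_ge0.
Unshelve. all: by end_near. Qed.

Theorem contracting_upper_box_dim n (K : set 'rV[C]_n) phi J (eta r : R) :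
    (0 < n)%N -> C11 phi J -> 0 < eta < 1 ->
    (forall z, normc (\det (J z)) = eta) ->
    (forall z, K z -> nrm z <= r) -> K `<=` phi @` K ->
  (upper_box_dim (@realify R n @` K) < ((2 * n)%:R : R)%:E)%E.
Proof.
move=> n0 phiC eta01 detJ Kr Kphi.
have [sigma [e0 [N0 [sigma01 e00 N01 q1 cov]]]] :=
  contracting_covered n0 phiC eta01 detJ Kr Kphi.
have /andP[sigma0 sigma1] := sigma01.
have La0 : 0 < - ln sigma by rewrite oppr_gt0 ln_lt0 // sigma0.
have ln2 : 0 < ln (2 : R) by rewrite ln_gt0 // ltr1n.
apply: (@le_lt_trans _ _ ((2 * n)%:R - ln 2 / (2 * - ln sigma))%:E).
  apply: (upper_box_dim_le sigma01 e00 N01 q1 cov).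
  rewrite lnV ?posrE ?mulr_gt0 ?exprn_gt0 // lnM ?posrE ?exprn_gt0 // lnXn //.
  rewrite ltr_pdivrMr // mulrBl -[_ *+ (2 * n)]mulr_natl.
  by rewrite invfM mulrA divfK ?lt0r_neq0 //; clear -ln2; lra.
rewrite lte_fin gtrDl oppr_lt0 divr_gt0 // mulr_gt0 //.
Qed.
End Dimension.

(** * Polynomial maps *)

Section Polynomials.
Variable R : realType.
Local Notation C := (complex R).
Local Notation "{ 'mpoly' T [ k ] }" := (mpoly k T)
  (at level 0, T at level 2, k at level 2).

Definition ev n (p : {mpoly C[n]}) (z : 'rV[C]_n) : C :=
  meval (fun j => z ord0 j) p.

Definition grad n (p : {mpoly C[n]}) (z : 'rV[C]_n) : 'cV[C]_n :=
  \col_i ev (mderiv i p) z.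

Lemma gradE n (p : {mpoly C[n]}) z i j : grad p z i j = ev (mderiv i p) z.
Proof. by rewrite mxE. Qed.

Lemma evC n (a : C) z : @ev n (mpolyC n a) z = a.
Proof. exact: mevalC. Qed.

Lemma evD n (p q : {mpoly C[n]}) z : ev (p + q) z = ev p z + ev q z.
Proof. exact: mevalD. Qed.

Lemma evM n (p q : {mpoly C[n]}) z : ev (p * q) z = ev p z * ev q z.
Proof. exact: mevalM. Qed.

Definition C11_poly n (p : {mpoly C[n]}) := C11_fun (ev p) (grad p).

Lemma C11_poly_const n (a : C) : C11_poly (mpolyC n a).
Proof.
have -> : C11_poly (mpolyC n a) = C11_fun (fun=> a) (fun=> 0 : 'cV[C]_n).
  congr C11_fun; first by apply/funext => z; exact: evC.
  apply/funext => z; apply/matrixP => i j.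
  by rewrite gradE mderivC [RHS]mxE; exact: meval0.
exact: C11_fun_const.
Qed.

Lemma C11_poly_var n (i : 'I_n) : C11_poly (mpolyvar C i).
Proof.
have -> : C11_poly (mpolyvar C i) =
    C11_fun (fun z : 'rV[C]_n => z 0 i) (fun=> delta_mx i 0).
  congr C11_fun; first by apply/funext => z; exact: mevalXU.
  apply/funext => z; apply/matrixP => j k.
  rewrite gradE [RHS]mxE (ord1 k) eqxx andbT mderivX mnm1E.
  rewrite /ev mevalZ mevalX [j == i]eq_sym.
  have [->|_] := eqVneq i j; last by rewrite mul0r.
  rewrite mul1r big1 // => l _.
  by rewrite mnmBE mnm1E subnn expr0.
exact: C11_fun_var.
Qed.

Lemma C11_polyD n (p q : {mpoly C[n]}) :
  C11_poly p -> C11_poly q -> C11_poly (p + q).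
Proof.
move=> pC qC.
have -> : C11_poly (p + q) = C11_fun (fun z => ev p z + ev q z)
    (fun z => grad p z + grad q z).
  congr C11_fun; first by apply/funext => z; exact: evD.
  apply/funext => z; apply/matrixP => i j.
  by rewrite gradE mderivD evD [RHS]mxE !gradE.
exact: (@C11_funD _ _ (ev p) (ev q) (grad p) (grad q) pC qC).
Qed.

Lemma C11_polyM n (p q : {mpoly C[n]}) :
  C11_poly p -> C11_poly q -> C11_poly (p * q).
Proof.
move=> pC qC.
have -> : C11_poly (p * q) = C11_fun (fun z => ev p z * ev q z)
    (fun z => ev q z *: grad p z + ev p z *: grad q z).
  congr C11_fun; first by apply/funext => z; exact: evM.
  apply/funext => z; apply/matrixP => i j.
  rewrite gradE mderivM evD !evM [RHS]mxE [X in _ = X + _]mxE [X in _ = _ + X]mxE.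
  by rewrite !gradE [X in X + _ = _]mulrC.
exact: (@C11_funM _ _ (ev p) (ev q) (grad p) (grad q) pC qC).
Qed.

Lemma C11_polyP n (p : {mpoly C[n]}) : C11_poly p.
Proof.
have C1 : C11_poly (1 : {mpoly C[n]}) by exact: C11_poly_const.
have C0 : C11_poly (0 : {mpoly C[n]}).
  by rewrite -mpolyC0; exact: C11_poly_const.
rewrite (mpolyE p); apply: (big_ind (@C11_poly n) C0 (@C11_polyD n)) => m _.
rewrite -mul_mpolyC; apply: C11_polyM; first exact: C11_poly_const.
rewrite mpolyXE_id; apply: (big_ind (@C11_poly n) C1 (@C11_polyM n)) => i _.
elim: (m i) => [|k IH]; first by rewrite expr0.
by rewrite exprS; apply: C11_polyM IH; exact: C11_poly_var.
Qed.

(** The rows are indexed by the variables, as required by the row-vector convention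
    of C11; the transpose of the matrix in jacobian_det. *)
Definition jac n m (f : m.-tuple {mpoly C[n]}) (z : 'rV[C]_n) : 'M[C]_(n, m) :=
  \matrix_(i, j) ev (mderiv i (tnth f j)) z.

Lemma C11_polymap n m (f : m.-tuple {mpoly C[n]}) : C11 (polymap f) (jac f).
Proof.
apply: C11_coord => i; have := C11_polyP (tnth f i); congr C11_fun.
  by apply/funext => z; rewrite mxE.
by apply/funext => z; apply/colP => j; rewrite !mxE.
Qed.

Lemma det_jac n (f : n.-tuple {mpoly C[n]}) z :
  \det (jac f z) = jacobian_det f z.
Proof.
rewrite -det_tr; congr (\det _); apply/matrixP => i j.
by rewrite [LHS]mxE [LHS]mxE [RHS]mxE.
Qed.

Lemma mnm_neq0_ge n (m : multinom n) : m != mnm0 ->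
  exists2 i, m i != 0%N & lem (mnm1 i) m.
Proof.
move=> m0; have /existsP[i mi] : [exists i, m i != 0%N].
  rewrite -negb_forall; apply: contra m0 => /forallP m0.
  by apply/eqP/mnmP => i; rewrite mnm0E; apply/eqP.
exists i => //; apply/mnm_lepP => j; rewrite mnm1E.
by case: eqP => // <-; rewrite lt0n.
Qed.

Lemma ev0 n (p : {mpoly C[n]}) : ev p 0 = mcoeff mnm0 p.
Proof.
rewrite {2}(mpolyE p) raddf_sum /ev mevalE; apply: eq_bigr => m _.
rewrite /= mcoeffZ mcoeffX; congr (_ * _); have [->|m0] := eqVneq m mnm0.
  by rewrite big1 // => i _; rewrite mnm0E expr0.
have [i mi Um] := mnm_neq0_ge m0.
by rewrite (bigD1 i) //= mxE expr0n (negPf mi) mul0r.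
Qed.

Lemma ev_eq0_mderiv n (p : {mpoly C[n]}) i :
  (forall z, ev p z = 0) -> forall z, ev (mderiv i p) z = 0.
Proof.
move=> p0 z.
have pC : C11 (polymap [tuple p]) (jac [tuple p]) by exact: C11_polymap.
have zC : C11 (polymap [tuple (0 : {mpoly C[n]})]) (jac [tuple (0 : {mpoly C[n]})]).
  exact: C11_polymap.
have : jac [tuple p] z = jac [tuple (0 : {mpoly C[n]})] z.
  apply: (C11_unique pC zC) => w; apply/rowP => j.
  by rewrite !mxE !ord1 !tnth0 -/(ev p w) p0 meval0.
by move/matrixP/(_ i 0); rewrite !mxE !tnth0 mderiv0 /ev meval0.
Qed.

(** The partial derivatives of a polynomial that vanishes identically vanish
    identically, so the claim on the coefficient of index m follows by induction on
    the degree of m; the constant coefficient is the value at 0. *)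
Lemma ev_eq0 n (p : {mpoly C[n]}) : (forall z, ev p z = 0) -> p = 0.
Proof.
move=> p0; apply/mpolyP => m; rewrite mcoeff0.
have [k] := ubnP (mdeg m); elim: k => // k IH in p p0 m *.
have [->|m0] := eqVneq m mnm0; first by rewrite -ev0 p0.
have [i mi Um] := mnm_neq0_ge m0.
move=> mk; have : mcoeff (mnm_sub m (mnm1 i)) (mderiv i p) = 0.
  apply: IH; first exact: ev_eq0_mderiv.
  by move: mk; rewrite -{1}(submK Um) mdegD mdeg1 addn1 ltnS.
by rewrite mcoeff_mderiv submK // => /eqP; rewrite mulrn_eq0 => /eqP.
Qed.

(** On the line through two points the polynomial restricts to a univariate
    polynomial without roots, which is constant as the field is algebraically
    closed. *)
Lemma ev_neq0_const n (p : {mpoly C[n]}) :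
  (forall z, ev p z != 0) -> forall z w, ev p z = ev p w.
Proof.
move=> p0 z w.
pose q : {poly C} := mmap (@polyC C)
  (fun j => (z 0 j)%:P + (w 0 j - z 0 j) *: 'X) p.
have qE t : q.[t] = ev p (z + t *: (w - z)).
  rewrite /ev mevalE /q /mmap horner_sum; apply: eq_bigr => m _.
  rewrite hornerM hornerC /mmap1 horner_prod; congr (_ * _).
  apply: eq_bigr => i _; rewrite horner_exp hornerD hornerC hornerZ hornerX.
  by rewrite !mxE mulrC.
have /size_poly1P[c _ qc] : size q == 1%N.
  apply/negPn/negP => /closed_rootP[t]; rewrite rootE qE.
  by apply/negP.
have := qE 0; have := qE 1.
by rewrite qc !hornerC scale0r addr0 scale1r addrCA subrr addr0 => <- <-.
Qed.

Lemma jacobian_det_ev n (f : n.-tuple {mpoly C[n]}) z :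
  jacobian_det f z = ev (\det (\matrix_(i, j) mderiv j (tnth f i))) z.
Proof.
rewrite /ev -det_map_mx; congr (\det _).
by apply/matrixP => i j; rewrite !mxE.
Qed.

(** The chain rule for the composite with the inverse, which is the identity. *)
Lemma jac_inverse n (f : polyaut C n) z :
  jac (aut_fun f) z *m jac (aut_inv f) (polymap (aut_fun f) z) = 1%:M.
Proof.
have compC := C11_comp (C11_polymap (aut_fun f)) (C11_polymap (aut_inv f)).
exact: (C11_unique compC (@C11_id R n) (aut_funK f) z).
Qed.

Lemma jacobian_det_inverse n (f : polyaut C n) z :
  jacobian_det (aut_fun f) z *
  jacobian_det (aut_inv f) (polymap (aut_fun f) z) = 1.
Proof. by rewrite -!det_jac -det_mulmx jac_inverse det1. Qed.

Lemma jacobian_det_const n (f : polyaut C n) z w :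
  jacobian_det (aut_fun f) z = jacobian_det (aut_fun f) w.
Proof.
rewrite !jacobian_det_ev; apply: ev_neq0_const => x.
rewrite -jacobian_det_ev; apply/eqP => x0.
by have := jacobian_det_inverse f x; rewrite x0 mul0r => /esym/eqP; rewrite oner_eq0.
Qed.

Lemma mdeg_polydeg n m (f : m.-tuple {mpoly C[n]}) i mon :
  mon \in msupp (tnth f i) -> (mdeg mon <= polydeg f)%N.
Proof.
move=> /msize_mdeg_lt lt; apply: leq_trans (leq_bigmax i).
by case: (msize _) lt.
Qed.

Lemma polydeg_le n m (f : m.-tuple {mpoly C[n]}) d :
  (forall i mon, mon \in msupp (tnth f i) -> (mdeg mon <= d)%N) ->
  (polydeg f <= d)%N.
Proof.
move=> fd; apply/bigmax_leqP => i _.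
suff : (msize (tnth f i) <= d.+1)%N by case: (msize _).
by rewrite msizeE; apply/bigmax_leqP_seq => mon /fd.
Qed.

(** If the inverse is affine, its Jacobian matrix is constant, hence so is that of
    f, and a monomial of f of degree at least 2 would give a nonconstant partial
    derivative. *)
Lemma polydeg_inverse n (f : polyaut C n) :
  (polydeg (aut_inv f) <= 1)%N -> (polydeg (aut_fun f) <= 1)%N.
Proof.
move=> g1; pose B := jac (aut_inv f) 0.
have BE w : jac (aut_inv f) w = B.
  apply/matrixP => i j; rewrite !mxE.
  have -> : mderiv i (tnth (aut_inv f) j) =
      mpolyC n (mcoeff mnm0 (mderiv i (tnth (aut_inv f) j))).
    apply/mpolyP => m; rewrite mcoeffC.
    have [->|m0] := eqVneq m mnm0; first by rewrite mulr1.
    rewrite mulr0 mcoeff_mderiv memN_msupp_eq0 ?mul0rn //.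
    apply/negP => /mdeg_polydeg; rewrite leqNgt mdegD mdeg1 addn1 ltnS.
    by rewrite (leq_trans g1) // lt0n mdeg_eq0.
  by rewrite /ev !mevalC.
have BJ z : jac (aut_fun f) z *m B = 1%:M.
  by rewrite -(BE (polymap (aut_fun f) z)) jac_inverse.
have JE z w : jac (aut_fun f) z = jac (aut_fun f) w.
  by rewrite -[LHS]mulmx1 -(mulmx1C (BJ w)) mulmxA BJ mul1mx.
apply: polydeg_le => i m mf; rewrite leqNgt; apply/negP => m2.
have m0 : m != mnm0 by apply: contraTneq m2 => ->; rewrite mdeg0.
have [j mj Um] := mnm_neq0_ge m0.
set p := tnth (aut_fun f) i in mf.
have : mderiv j p - mpolyC n (ev (mderiv j p) 0) = 0.
  apply: ev_eq0 => z; rewrite /ev mevalB mevalC -!/(ev _ _).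
  by have /matrixP/(_ j i) := JE z 0; rewrite !mxE => ->; rewrite subrr.
move/mpolyP/(_ (mnm_sub m (mnm1 j))); rewrite mcoeffB mcoeff_mderiv submK //.
rewrite mcoeffC mcoeff0; case: eqP => [m10|_].
  by move: m2; rewrite -(submK Um) m10 mdegD mdeg0 mdeg1.
rewrite mulr0 subr0 => /eqP; rewrite mulrn_eq0 /= => /eqP p0.
by move: mf; rewrite mcoeff_msupp p0 eqxx.
Qed.
End Polynomials.

(** * Positive functions on the unit sphere *)

Section LowerBounds.
Variable R : realType.
Local Notation C := (complex R).

Lemma nrm_le_realify n (z : 'rV[C]_n) : nrm z <= 2 * `|realify z|.
Proof.
have le i : `|realify z 0 i| <= `|realify z|.
  rewrite -[X in _ <= X]/(mx_norm (realify z)) mx_normrE.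
  exact: (le_bigmax 0 (fun i : 'I_1 * 'I_(n + n) => `|realify z i.1 i.2|) (0, i)).
apply: nrm_le => [|k j]; first by rewrite mulr_ge0.
rewrite ord1 (le_trans (ler_normcReIm _)) // mulr2n mulrDl mul1r lerD //.
  by have := le (lshift n j); rewrite /realify row_mxEl mxE.
by have := le (rshift n j); rewrite /realify row_mxEr mxE.
Qed.

Lemma realify_le_nrm n (z : 'rV[C]_n) : `|realify z| <= nrm z.
Proof.
rewrite -[X in X <= _]/(mx_norm (realify z)) mx_normrE.
apply: bigmax_le => [|[k l] _ /=]; first exact: nrm_ge0.
rewrite /realify -[l]fintype.splitK; case: (fintype.split l) => j /=.
  by rewrite row_mxEl mxE (le_trans (ler_Re_normc _)) // le_nrm.
by rewrite row_mxEr mxE (le_trans (ler_Im_normc _)) // le_nrm.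
Qed.

(** Compactness of the sphere is that of closed bounded sets of real row vectors,
    hence the transport through C^n = R^(2n). *)
Definition unrealify n (x : 'rV[R]_(n + n)) : 'rV[C]_n :=
  \row_i Complex (x 0 (lshift n i)) (x 0 (rshift n i)).

Lemma realifyK n : cancel (@realify R n) (@unrealify n).
Proof.
move=> z; apply/rowP => i; rewrite mxE row_mxEl row_mxEr !mxE.
by case: (z 0 i).
Qed.

Lemma unrealifyK n : cancel (@unrealify n) (@realify R n).
Proof.
move=> x; apply/rowP => k; rewrite /realify -[k]fintype.splitK.
by case: (fintype.split k) => j /=; rewrite ?row_mxEl ?row_mxEr !mxE.
Qed.

Lemma unrealifyB n (x y : 'rV[R]_(n + n)) :
  unrealify (x - y) = unrealify x - unrealify y.
Proof. by apply/rowP => i; rewrite !mxE. Qed.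

Lemma nrm_unrealify n (x : 'rV[R]_(n + n)) :
  nrm (unrealify x) <= 2 * `|x| /\ `|x| <= nrm (unrealify x).
Proof.
have := nrm_le_realify (unrealify x); have := realify_le_nrm (unrealify x).
by rewrite unrealifyK.
Qed.

Definition lipschitz_on_balls n (h : 'rV[C]_n -> R) :=
  forall r, exists2 c, 0 <= c & forall z w, nrm z <= r -> nrm w <= r ->
    `|h w - h z| <= c * nrm (w - z).

Lemma near_norm_dist n (x : 'rV[R]_n) d : 0 < d ->
  \forall y \near x, `|x - y| <= d.
Proof.
move=> d0; apply/nbhs_ballP; exists d => //= y.
by rewrite mx_norm_ball /ball_ => /ltW.
Qed.

Lemma lipschitz_continuous n (h : 'rV[C]_n -> R) :
  lipschitz_on_balls h -> continuous (h \o @unrealify n).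
Proof.
move=> hL x; have nx : Filter (nbhs x) by exact: nbhs_filter.
apply/(@cvgrPdist_le _ _ _ (nbhs x) nx) => e e0.
have [c c0 cP] := hL (2 * (`|x| + 1)).
have d0 : 0 < e / (2 * c + 1) by rewrite divr_gt0 //; lra.
near=> y.
have xy : `|x - y| <= e / (2 * c + 1).
  by near: y; exact: near_norm_dist.
have xy1 : `|x - y| <= 1.
  by near: y; exact: near_norm_dist.
have yx : `|y| <= `|x| + 1.
  by rewrite -[y](subKr x) (le_trans (ler_normB _ _)) // lerD2l.
apply: le_trans (cP (unrealify y) (unrealify x) _ _) _.
- by rewrite (le_trans (nrm_unrealify _).1) // ler_wpM2l.
- by rewrite (le_trans (nrm_unrealify _).1) // ler_wpM2l // lerDl.
rewrite -unrealifyB; apply: (@le_trans _ _ (c * (2 * `|x - y|))).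
  by rewrite ler_wpM2l // (nrm_unrealify _).1.
move: xy; rewrite ler_pdivlMr; last lra.
have := normr_ge0 (x - y); clear; move: `|x - y| => t; nra.
Unshelve. all: by end_near. Qed.

Lemma lipschitz_nrm n : lipschitz_on_balls (@nrm R 1 n).
Proof.
move=> r; exists 1 => // z w _ _; rewrite mul1r ler_norml.
have := ler_nrmD (w - z) z; have := ler_nrmD (z - w) w.
rewrite !subrK (nrm_distrC z w); clear; lra.
Qed.

Lemma lipschitz_nrm_C11 n m (phi : 'rV[C]_n -> 'rV[C]_m) J :
  C11 phi J -> lipschitz_on_balls (fun z => nrm (phi z)).
Proof.
move=> /C11_lipschitz phiL r; have [c c0 cP] := phiL r.
exists c => // z w zr wr; rewrite (le_trans _ (cP z w zr wr)) //.
rewrite ler_norml.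
have := ler_nrmD (phi w - phi z) (phi z); have := ler_nrmD (phi z - phi w) (phi w).
rewrite !subrK (nrm_distrC (phi z)); clear; lra.
Qed.

Lemma lipschitzD n (g h : 'rV[C]_n -> R) : lipschitz_on_balls g ->
  lipschitz_on_balls h -> lipschitz_on_balls (fun z => g z + h z).
Proof.
move=> gL hL r; have [c c0 cP] := gL r; have [d d0 dP] := hL r.
exists (c + d) => [|z w zr wr]; first exact: addr_ge0.
have -> : g w + h w - (g z + h z) = (g w - g z) + (h w - h z) by ring.
by rewrite (le_trans (ler_normD _ _)) // mulrDl lerD ?cP ?dP.
Qed.

(** The infimum is attained, since the sphere is compact and h is continuous. *)
Lemma sphere_lower_bound n (h : 'rV[C]_n -> R) : lipschitz_on_balls h ->
    (forall z, nrm z = 1 -> 0 < h z) ->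
  exists2 c, 0 < c & forall z, nrm z = 1 -> c <= h z.
Proof.
move=> hL h0; pose S := (@nrm R 1 n \o @unrealify n) @^-1` [set 1].
have [[z0 z01]|noz] := pselect (exists z : 'rV[C]_n, nrm z = 1); last first.
  by exists 1 => // z z1; case: noz; exists z.
have S0 : S !=set0 by exists (realify z0); rewrite /S /= realifyK.
have cS : compact S.
  apply: bounded_closed_compact.
    exists 1; split; first exact: num_real.
    move=> M M1 x Sx /=; rewrite (le_trans (nrm_unrealify x).2) //.
    by move: Sx; rewrite /S /= => ->; exact: ltW.
  apply: closed_comp; last exact: closed_eq.
  by move=> x _; exact: (lipschitz_continuous (@lipschitz_nrm n)).
have [x Sx xmin] := EVT_min_rV S0 cS
  (continuous_subspaceT (lipschitz_continuous hL)).
rewrite inE in Sx.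
exists (h (unrealify x)); first exact: h0.
move=> z z1; have := xmin (realify z); rewrite /= realifyK; apply.
by rewrite inE /S /= realifyK.
Qed.

End LowerBounds.

(** * Escape to infinity of unbounded orbits *)

Section Escape.
Variable R : realType.
Local Notation C := (complex R).
Local Notation "{ 'mpoly' T [ k ] }" := (mpoly k T)
  (at level 0, T at level 2, k at level 2).

(** The point s * (1, z) of C^(n+1), a representative of z in P^n for s nonzero. *)
Definition scaled_lift n (s : C) (z : 'rV[C]_n) : 'rV[C]_n.+1 :=
  \row_i (if unlift ord0 i is Some j then s * z 0 j else s).

Lemma homogenize_scaled_lift n d (p : {mpoly C[n]}) s (z : 'rV[C]_n) :
    (forall m, m \in msupp p -> (mdeg m <= d)%N) ->
  ev (homogenize d p) (scaled_lift s z) = s ^+ d * ev p z.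
Proof.
move=> pd; rewrite /ev /homogenize raddf_sum mevalE mulr_sumr /=.
rewrite big_seq [RHS]big_seq; apply: eq_bigr => m /pd md.
rewrite mevalZ mevalM rmorphXn rmorph_prod /= mevalXU mxE unlift_none.
rewrite [RHS]mulrCA; congr (_ * _).
have -> : \prod_(i < n) meval (fun j => scaled_lift s z ord0 j)
    (mpolyvar C (lift ord0 i) ^+ m i) =
    s ^+ mdeg m * \prod_(i < n) z ord0 i ^+ m i.
  rewrite mdegE -prodrXr -big_split /=; apply: eq_bigr => i _.
  by rewrite rmorphXn /= mevalXU mxE liftK exprMn.
by rewrite mulrA -exprD subnK.
Qed.

Lemma nrm_scaled_lift n (s : C) (z : 'rV[C]_n) : 1 <= nrm z ->
  nrm (scaled_lift s z) = normc s * nrm z.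
Proof.
move=> z1; apply/eqP; rewrite eq_le; apply/andP; split.
  apply: nrm_le => [|i j]; first by rewrite mulr_ge0 ?normc_ge0 ?nrm_ge0.
  rewrite mxE; case: unliftP => [k|] _.
    by rewrite normcM ler_wpM2l ?normc_ge0 ?le_nrm.
  by rewrite ler_peMr ?normc_ge0.
rewrite -nrmZ; apply: nrm_le => [|i j]; first exact: nrm_ge0.
have := le_nrm (scaled_lift s z) 0 (lift ord0 j).
by rewrite [X in normc X]mxE liftK ord1 [X in _ -> normc X <= _]mxE.
Qed.

(** On s * (1, z) the homogeneous lift takes the value s^d * (1, f z), where d is
    the degree of f. *)
Lemma nrm_homlift n (f : n.-tuple {mpoly C[n]}) s (z : 'rV[C]_n) :
  nrm (polymap (homlift f) (scaled_lift s z)) <=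
  normc s ^+ polydeg f * (1 + nrm (polymap f z)).
Proof.
have sd : 0 <= normc s ^+ polydeg f by rewrite exprn_ge0 ?normc_ge0.
apply: nrm_le => [|i j]; first by rewrite mulr_ge0 // addr_ge0 // nrm_ge0.
rewrite mxE; case: (unliftP ord0 j) => [k ->|->].
  rewrite tnthS tnth_map -/(ev _ _) homogenize_scaled_lift; last first.
    by move=> m; exact: mdeg_polydeg.
  rewrite normcM normcX ler_wpM2l // (@le_trans _ _ (nrm (polymap f z))) //.
    by have := le_nrm (polymap f z) 0 k; rewrite mxE.
  by rewrite lerDr.
rewrite tnth0 rmorphXn /= mevalXU mxE unlift_none normcX.
by rewrite ler_peMr // lerDl nrm_ge0.
Qed.

Lemma homlift_no_common_zero n (f : polyaut C n) w :
    indeterminacy (aut_fun f) `&` indeterminacy (aut_inv f) = set0 ->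
    polymap (homlift (aut_fun f)) w = 0 ->
  polymap (homlift (aut_inv f)) w = 0 -> w = 0.
Proof.
move=> I0 f0 g0; apply/eqP/negPn/negP => w0.
suff : set0 <[w]>%VS by [].
by rewrite -I0; split; exists w.
Qed.

(** Let s = 1 / |z|.  The point s * (1, z) lies on the unit sphere of C^(n+1), so
    c <= s^d (1 + |f z|) + s^e (1 + |g z|) for the degrees d, e >= 2 of f and g.  If
    |f z| and |g z| were less than 2 |z|, the right-hand side would be at most
    6 s, which is less than c for |z| > 1 + 6 / c. *)
Lemma escape n (f : polyaut C n) : (1 < polydeg (aut_fun f))%N ->
    indeterminacy (aut_fun f) `&` indeterminacy (aut_inv f) = set0 ->
  exists2 rho, 0 < rho & forall z, rho < nrm z ->
    2 * nrm z <= nrm (polymap (aut_fun f) z) \/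
    2 * nrm z <= nrm (polymap (aut_inv f) z).
Proof.
move=> d1 I0.
have e1 : (1 < polydeg (aut_inv f))%N.
  by rewrite ltnNge; apply: contraL d1 => /polydeg_inverse; rewrite -leqNgt.
have [c c0 cP] : exists2 c, 0 < c & forall w : 'rV[C]_n.+1, nrm w = 1 ->
    c <= nrm (polymap (homlift (aut_fun f)) w) +
         nrm (polymap (homlift (aut_inv f)) w).
  apply: sphere_lower_bound.
    by apply: lipschitzD; apply: lipschitz_nrm_C11; exact: C11_polymap.
  move=> w w1; rewrite lt_def addr_ge0 ?nrm_ge0 // andbT.
  rewrite paddr_eq0 ?nrm_ge0 //; apply/negP => /andP[/eqP f0 /eqP g0].
  have w0 := homlift_no_common_zero I0 (nrm_eq0 f0) (nrm_eq0 g0).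
  by move: w1; rewrite w0 nrm0 => /esym/eqP; rewrite oner_eq0.
exists (1 + 6 / c); first by rewrite addr_gt0 // divr_gt0.
move=> z zrho.
have z1 : 1 < nrm z by rewrite (le_lt_trans _ zrho) // lerDl divr_ge0 // ltW.
have z0 : 0 < nrm z by exact: lt_trans z1.
have [?|fz] := leP (2 * nrm z) (nrm (polymap (aut_fun f) z)); first by left.
have [?|gz] := leP (2 * nrm z) (nrm (polymap (aut_inv f) z)); first by right.
exfalso.
pose s := (nrm z)^-1.
have s0 : 0 < s by rewrite invr_gt0.
have s1 : s <= 1 by rewrite invf_le1 // ltW.
have ns : normc (real_complex R s) = s by rewrite normc_real gtr0_norm.
have w1 : nrm (scaled_lift (real_complex R s) z) = 1.
  by rewrite nrm_scaled_lift ?ltW // ns mulVf // lt0r_neq0.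
have bound d (q : R) : (1 < d)%N -> 0 <= q -> q < 2 * nrm z ->
    s ^+ d * (1 + q) <= 3 * s.
  move=> d2 q0 qz; apply: (@le_trans _ _ (s ^+ 2 * (3 * nrm z))).
    rewrite ler_pM ?exprn_ge0 ?addr_ge0 ?(ltW s0) //.
      by rewrite ler_wiXn2l // ltW.
    by clear -qz z1; lra.
  by rewrite expr2 /s mulrACA mulVf ?lt0r_neq0 // mulr1 mulrC.
have := cP _ w1; apply/negP; rewrite -ltNge.
apply: le_lt_trans (lerD (nrm_homlift _ _ _) (nrm_homlift _ _ _)) _.
rewrite ns; apply: le_lt_trans (lerD (bound _ _ d1 (nrm_ge0 _) fz)
  (bound _ _ e1 (nrm_ge0 _) gz)) _.
rewrite -mulrDl /s ltr_pdivrMr // mulrC -ltr_pdivrMr //.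
by apply: lt_trans zrho; rewrite -natrD ltrDr.
Qed.

Lemma bounded_orbitP n (f : n.-tuple {mpoly C[n]}) p :
  bounded_orbit f p <-> exists M, forall k, nrm (iter k (polymap f) p) <= M.
Proof.
split=> [[M [_ MP]]|[M MP]].
  exists (2 * (M + 1)) => k; rewrite (le_trans (nrm_le_realify _)) //.
  by rewrite ler_wpM2l // (MP (M + 1)) ?ltrDl //; exists k.
exists M; split; first exact: num_real.
move=> N MN _ [k _ <-] /=; rewrite (le_trans (realify_le_nrm _)) //.
exact: le_trans (MP k) (ltW MN).
Qed.

Lemma bounded_orbit_image n (f : n.-tuple {mpoly C[n]}) p :
  bounded_orbit f p -> bounded_orbit f (polymap f p).
Proof.
move=> /bounded_orbitP[M MP]; apply/bounded_orbitP; exists M => k.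
by rewrite -iterSr.
Qed.

Lemma bounded_orbit_preimage n (f g : n.-tuple {mpoly C[n]}) p :
    cancel (polymap g) (polymap f) ->
  bounded_orbit f p -> bounded_orbit f (polymap g p).
Proof.
move=> gK /bounded_orbitP[M MP]; apply/bounded_orbitP.
exists (Num.max M (nrm (polymap g p))) => -[|k].
  by rewrite le_max lexx orbT.
by rewrite iterSr gK le_max MP.
Qed.

(** From a point p of K outside the ball of radius rho, applying f or g, whichever
    doubles the norm, can be repeated for ever.  The points obtained stay in the
    full orbit S of p, which is bounded. *)
Lemma Kset_bounded n (f : polyaut C n) : regular_aut f ->
  exists rho, forall z, Kset f z -> nrm z <= rho.
Proof.
move=> [d1 I0]; have [rho rho0 esc] := escape d1 I0; exists rho => p.
move=> [/bounded_orbitP[M MP] /bounded_orbitP[N NP]].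
rewrite leNgt; apply/negP => rhop.
pose F := polymap (aut_fun f); pose G := polymap (aut_inv f).
pose S := [set q | exists k, q = iter k F p \/ q = iter k G p].
have SF q : S q -> S (F q).
  case=> -[|k] [] -> /=; [by exists 1%N; left | by exists 1%N; left |
    by exists k.+2; left | by exists k; right; rewrite /F /G aut_invK].
have SG q : S q -> S (G q).
  case=> -[|k] [] -> /=; [by exists 1%N; right | by exists 1%N; right |
    by exists k; left; rewrite /F /G aut_funK | by exists k.+2; right].
have SM q : S q -> nrm q <= Num.max M N.
  rewrite le_max => -[k [] ->]; apply/orP; first by left; exact: MP.
  by right; exact: NP.
have grow k : exists2 q, S q & 2 ^+ k * nrm p <= nrm q.
  elim: k => [|k [q Sq pq]]; first by exists p; [exists 0%N; left|rewrite mul1r].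
  have rhoq : rho < nrm q.
    rewrite (lt_le_trans rhop) // (le_trans _ pq) // ler_peMl ?nrm_ge0 //.
    by rewrite exprn_ege1 // ler1n.
  have pq2 : 2 ^+ k.+1 * nrm p <= 2 * nrm q by rewrite exprS -mulrA ler_wpM2l.
  case: (esc _ rhoq) => /(le_trans pq2) pq'.
    by exists (F q); [exact: SF|].
  by exists (G q); [exact: SG|].
have p0 : 0 < nrm p by exact: lt_trans rhop.
have MN0 : 0 <= Num.max M N by rewrite le_max (le_trans _ (MP 0%N)) // nrm_ge0.
have e0 : 0 < nrm p / (Num.max M N + 1) by rewrite divr_gt0 // ltr_wpDl.
have half : 0 < (2^-1 : R) < 1 by apply/andP; split; lra.
have [k kP] := expr_small half e0; have [q Sq pq] := grow k.
have := le_trans pq (SM q Sq); apply/negP; rewrite -ltNge.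
move: kP; rewrite ler_pdivlMr ?ltr_wpDl // exprVn ler_pdivrMl ?exprn_gt0 //.
by apply: lt_le_trans; rewrite ltrDl.
Qed.

Lemma Kset_image n (f : polyaut C n) :
  Kset f `<=` polymap (aut_fun f) @` Kset f.
Proof.
move=> z [zp zm]; exists (polymap (aut_inv f) z); last exact: aut_invK.
split; last exact: (@bounded_orbit_image _ _ z zm).
exact: bounded_orbit_preimage (aut_invK f) zp.
Qed.

Lemma Kset_preimage n (f : polyaut C n) :
  Kset f `<=` polymap (aut_inv f) @` Kset f.
Proof.
move=> z [zp zm]; exists (polymap (aut_fun f) z); last exact: aut_funK.
split; first exact: (@bounded_orbit_image _ _ z zp).
exact: bounded_orbit_preimage (aut_funK f) zm.
Qed.
End Escape.

(** * The filled Julia set of a regular automorphism *)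

Theorem corollary5p3 (R : realType) (n : nat) (hn : (2 <= n)%N)
    (f : polyaut (complex R) n) (hreg : regular_aut f)
    (hvol : ~ volume_preserving f) :
  (upper_box_dim (@realify R n @` Kset f) < ((2 * n)%:R : R)%:E)%E.
Proof.
have n0 : (0 < n)%N by exact: ltnW.
have [rho Krho] := Kset_bounded hreg.
pose F := polymap (aut_fun f); pose G := polymap (aut_inv f).
pose eta := normc (jacobian_det (aut_fun f) 0).
have etaF z : normc (\det (jac (aut_fun f) z)) = eta.
  by rewrite det_jac (jacobian_det_const f z 0).
have eta0 : 0 < eta.
  rewrite lt_def normc_ge0 andbT; apply/eqP => eta0.
  have := jacobian_det_inverse f 0.
  by rewrite (eq0_normc eta0) mul0r => /esym/eqP; rewrite oner_eq0.
have etaG z : normc (\det (jac (aut_inv f) z)) = eta^-1.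
  have detFG := jacobian_det_inverse f (G z).
  rewrite (jacobian_det_const f (G z) 0) (aut_invK f z) in detFG.
  by rewrite det_jac; exact: normc_mul_eq1 detFG.
have [eta1|eta1|eta1] := ltgtP eta 1.
- apply: (contracting_upper_box_dim n0 (C11_polymap (aut_fun f)) _ etaF Krho).
    by rewrite eta0.
  exact: Kset_image.
- apply: (contracting_upper_box_dim n0 (C11_polymap (aut_inv f)) _ etaG Krho).
    by rewrite invr_gt0 eta0 invf_lt1.
  exact: Kset_preimage.
case: hvol => z; rewrite (jacobian_det_const f z 0).
by have := congr1 (real_complex R) eta1.
Qed.
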